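(* There exists a universal constant $c>0$ such that the following holds. Let $q>1$ and $n\ge1$ be integers, let $\gamma$ be a probability measure on $[q]=\{1,2,\dots,q\}$ with $\gamma(i)>0$ for all $i\in[q]$, and let $A,B$ be two increasing subsets of $[q]^n$. Then $$\gamma^{\otimes n}(A\cap B)-\gamma^{\otimes n}(A)\,\gamma^{\otimes n}(B)\ \ge\ c\,\max\left(\sum_{i=1}^n\frac{I_i^h(A)\,I_i^h(B)}{\sqrt{\log(1/I_i^h(A))\,\log(1/I_i^h(B))}},\ \varphi\Big(\sum_{i=1}^n I_i^h(A)\,I_i^h(B)\Big)\right),$$ where $h(t)=\phi(\Phi^{-1}(t))$ and $\varphi(x)=x/\log(e/x)$.
   Context: $\phi$ and $\Phi$ are the density and the distribution function of the standard Gaussian measure on $\mathbb{R}$; $h(t)=\phi(\Phi^{-1}(t))$ for $t\in(0,1)$ and $h(0)=h(1)=0$. A set $A\subseteq[q]^n$ is increasing if its characteristic function is increasing (non-decreasing) in each coordinate with respect to the usual order on $[q]$. For a set $A\subseteq[q]^n$, $1\le i\le n$ and $x\in[q]^n$, the fiber is $A_i^x=\{y\in[q]:(x_1,\dots,x_{i-1},y,x_{i+1},\dots,x_n)\in A\}$. The $h$-influence of the $i$-th coordinate on $A$ is $I_i^h(A):=\mathbb{E}[h(\gamma(A_i^x))]$, where $x$ is distributed according to $\gamma^{\otimes n}$. Conventions: $\varphi(0)=0$, and a summand in the first sum in which one of the two $h$-influences is $0$ is interpreted as $0$. *)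

(* Defs.v *)
From mathcomp Require Import all_boot all_order all_algebra.
From mathcomp Require Import all_classical all_reals all_analysis.

Set Implicit Arguments.
Unset Strict Implicit.
Unset Printing Implicit Defensive.

Import Order.TTheory GRing.Theory Num.Theory.
Local Open Scope ring_scope.

Section Gaussian.
Context {R : realType}.

Definition gauss_pdf (x : R) : R := normal_pdf 0 1 x.

Definition gauss_cdf (x : R) : R := fine (normal_prob 0 1 `]-oo, x]%classic).

(* The inverse on the range ]0, 1[ of [gauss_cdf]; only used there. *)
Definition gauss_quantile : R -> R := 'pinv_(fun=> 0) [set: R]%classic gauss_cdf.

Definition gauss_h (t : R) : R :=
  if (0 < t) && (t < 1) then gauss_pdf (gauss_quantile t) else 0.

(* x / log(e / x); the value at 0 is 0. *)
Definition talagrand_phi (x : R) : R := x / ln (expR 1 / x).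

End Gaussian.

(* A probability measure on a finite type is given by its values on points. *)
Section FiniteMeasures.
Context {R : realType}.

Definition is_pmf (T : finType) (p : T -> R) : Prop :=
  (forall t, 0 <= p t) /\ \sum_t p t = 1.

Definition fin_measure (T : finType) (p : T -> R) (S : {set T}) : R :=
  \sum_(t in S) p t.

Definition expectation_pmf (T : finType) (p : T -> R) (f : T -> R) : R :=
  \sum_t p t * f t.

Definition pmf_power (q n : nat) (gamma : 'I_q -> R)
  (x : {ffun 'I_n -> 'I_q}) : R := \prod_(i < n) gamma (x i).

End FiniteMeasures.

Section Cube.
Context {q n : nat}.
Implicit Types (A : {set {ffun 'I_n -> 'I_q}}) (x : {ffun 'I_n -> 'I_q}).

Definition update x (i : 'I_n) (y : 'I_q) : {ffun 'I_n -> 'I_q} :=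
  [ffun j => if j == i then y else x j].

Definition increasing_set A : Prop :=
  forall x (i : 'I_n) (y z : 'I_q), (y <= z)%N ->
    ((update x i y \in A) <= (update x i z \in A))%N.

Definition fiber A (i : 'I_n) x : {set 'I_q} := [set y | update x i y \in A].

Definition h_influence {R : realType} (gamma : 'I_q -> R) A (i : 'I_n) : R :=
  expectation_pmf (pmf_power gamma)
    (fun x => gauss_h (fin_measure gamma (fiber A i x))).

End Cube.

(* A summand where an influence is 0 has numerator 0, hence is 0. *)
Definition log_influence_sum {R : realType} (q n : nat) (gamma : 'I_q -> R)
    (A B : {set {ffun 'I_n -> 'I_q}}) : R :=
  \sum_(i < n)
    h_influence gamma A i * h_influence gamma B i /
    Num.sqrt (ln (1 / h_influence gamma A i) * ln (1 / h_influence gamma B i)).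

(* Main.v *)
Require Import Defs.
From mathcomp Require Import all_boot all_order all_algebra.
From mathcomp Require Import all_classical all_reals all_analysis.
From HB Require Import structures.
From mathcomp Require Import ring lra.

(** The covariance of two increasing events is bounded from below by coupling.
    Let x and y have law gamma^n, the pairs (x_i, y_i) being independent with law
      gamma(u) gamma(v) (1 + r_i a_i(u) b_i(v)),
    where a_i and b_i are nondecreasing with mean zero. This law lies between that
    of independent points and that of equal points: the fibers of increasing sets
    are nested, so P(x in A, y in B) is at most the measure of the intersection
    ([coupled_le_diagonal]). Turning on the correlations one coordinate after the
    other writes P(x in A, y in B) - P(A) P(B) as a sum of gains r_i E[F_i(x) G_i(y)]
    ([coupled_gains]), where F_i >= 0 is the sum of gamma a_i over the fiber of A in
    the direction i, averaged over the coordinates that are not yet correlated.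

    The influences enter through the choice of a_i. Lay out the points of [q] on the
    Gaussian line as consecutive intervals of measures gamma(u), the largest point
    leftmost, and let the score of u be minus the barycentre of its interval. The
    scores sum to phi(Phi^-1(t)) over a final segment of measure t
    ([sum_score_upset]), so with a_i equal to the score the mean of F_i is the
    h-influence of A. By Jensen's inequality the score inherits a bound on
    E[exp(3 a^2 / 8)] from the Gaussian measure ([mean_exp_score]), and truncating
    it at a level of the order of the square root of a logarithm of the influences
    changes little ([clipped_influence_err]).

    A gain is bounded from below by reverse hypercontractivity: for f, g >= 0,
    E[f(x) g(y)] is at least the product of the norms of f and g with exponents
    1/(1 + e) and 1/(1 + d) as soon as r^2 is at most a constant times e d and r
    times the product of the truncation levels is at most a constant
    ([tilted_reverse_hypercontractive], [coupled_reverse_hypercontractive]). These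
    norms are compared with means and second moments ([mean_powR_moment]):
    they are at least E f / 8 times (E[f]^2 / E[f^2])^e.

    For the sum over the coordinates, r_i is of order 1 / sqrt(log(1/I_i(A))
    log(1/I_i(B))), e = 1 / (2 log(1/I_i(A))), and the coordinates are taken in the
    order that makes each one at least as correlated as those still coupled in its
    gain ([gains_ge_sum]). For the second bound all r_i are of order 1 / log(e/S), S
    being the sum of the products of influences. Bessel's inequality bounds the
    sum of the second moments of the F_i ([energy_le]), so that the factors
    (E[F_i]^2 / E[F_i^2])^e cost only a constant where they matter
    ([gains_ge_energy]). *)

Set Implicit Arguments.
Unset Strict Implicit.
Unset Printing Implicit Defensive.

Import Order.TTheory GRing.Theory Num.Theory.
Local Open Scope ring_scope.

(** The unqualified name [expectation_pmf] denotes a lemma on random variables. *)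
Local Notation mean := Defs.expectation_pmf.

(** * Expectations on a finite probability space *)

Section Expectation.
Context {R : realType} {T : finType} {p : T -> R}.
Context (p_pmf : is_pmf p).
Implicit Types (f g : T -> R) (c : R).

Local Notation E := (mean p).

Lemma eq_mean f g : f =1 g -> E f = E g.
Proof. by move=> fg; apply: eq_bigr => t _; rewrite fg. Qed.

Lemma meanD f g : E (fun t => f t + g t) = E f + E g.
Proof. by rewrite /Defs.expectation_pmf -big_split; apply: eq_bigr => t _; rewrite mulrDr. Qed.

Lemma meanZ c f : E (fun t => c * f t) = c * E f.
Proof. by rewrite /expectation_pmf mulr_sumr; apply: eq_bigr => t _; rewrite mulrCA. Qed.

Lemma meanB f g : E (fun t => f t - g t) = E f - E g.
Proof. by rewrite /Defs.expectation_pmf -sumrB; apply: eq_bigr => t _; rewrite mulrBr. Qed.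

Lemma mean_cst c : E (fun=> c) = c.
Proof. by rewrite /Defs.expectation_pmf -mulr_suml p_pmf.2 mul1r. Qed.

Lemma mean_affine c d f g :
  E (fun t => 1 + c * f t + d * g t) = 1 + c * E f + d * E g.
Proof. by rewrite meanD (meanD (fun=> 1)) mean_cst !meanZ. Qed.

Lemma mean_le f g : (forall t, f t <= g t) -> E f <= E g.
Proof. by move=> fg; apply: ler_sum => t _; rewrite ler_wpM2l // p_pmf.1. Qed.

Lemma mean_ge0 f : (forall t, 0 <= f t) -> 0 <= E f.
Proof. by move=> f0; apply: sumr_ge0 => t _; rewrite mulr_ge0 // p_pmf.1. Qed.

Lemma mean_norm f : `|E f| <= E (fun t => `|f t|).
Proof.
apply: le_trans (ler_norm_sum _ _ _) _; apply: ler_sum => t _.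
by rewrite normrM ger0_norm // p_pmf.1.
Qed.

(** Nonnegativity of the quadratic form E[(xf + yg)^2]. *)
Lemma mean_CauchySchwarz f g :
  E (fun t => f t * g t) ^+ 2 <= E (fun t => f t ^+ 2) * E (fun t => g t ^+ 2).
Proof.
set a := E (fun t => f t ^+ 2); set b := E (fun t => g t ^+ 2).
set c := E (fun t => f t * g t).
have b0 : 0 <= b by apply: mean_ge0 => t; apply: sqr_ge0.
have key x y : 0 <= x ^+ 2 * a + 2 * (x * y) * c + y ^+ 2 * b.
  have -> : x ^+ 2 * a + 2 * (x * y) * c + y ^+ 2 * b =
      E (fun t => (x * f t + y * g t) ^+ 2).
    rewrite -!meanZ -!meanD; apply: eq_bigr => t _.
    by congr (_ * _); ring.
  by apply: mean_ge0 => t; apply: sqr_ge0.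
have [b_eq0|b_neq0] := eqVneq b 0; last first.
  have bp : 0 < b by rewrite lt_neqAle eq_sym b_neq0.
  have := key b (- c).
  have -> : b ^+ 2 * a + 2 * (b * - c) * c + (- c) ^+ 2 * b = b * (a * b - c ^+ 2) by ring.
  by rewrite pmulr_rge0 // subr_ge0.
have a0 : 0 <= a by apply: mean_ge0 => t; apply: sqr_ge0.
(* with b = 0 the form is affine in its second variable, so c must vanish *)
have := key c (- (a + 1)); rewrite b_eq0 mulr0 addr0.
have -> : c ^+ 2 * a + 2 * (c * - (a + 1)) * c = - (c ^+ 2 * (a + 2)) by ring.
by rewrite mulr0 oppr_ge0 pmulr_lle0 // ltr_wpDl.
Qed.

Lemma mean_sqr_le f : E f ^+ 2 <= E (fun t => f t ^+ 2).
Proof.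
have := mean_CauchySchwarz f (fun=> 1).
rewrite (@eq_mean (fun t => f t * 1) f) => [|t]; last by rewrite mulr1.
by rewrite (@eq_mean (fun=> 1 ^+ 2) (fun=> 1)) ?mean_cst ?mulr1 // => t; rewrite expr1n.
Qed.

End Expectation.

(** * Updating coordinates in a product space *)

Section Updates.
Context {q n : nat}.
Implicit Types (x y : {ffun 'I_n -> 'I_q}) (i j : 'I_n) (u v : 'I_q).

Lemma update_same x i u : update x i u i = u.
Proof. by rewrite ffunE eqxx. Qed.

Lemma update_update x i u v : update (update x i u) i v = update x i v.
Proof. by apply/ffunP => j; rewrite !ffunE; case: eqP. Qed.

Lemma update_comm x i j u v : i != j ->
  update (update x i u) j v = update (update x j v) i u.
Proof.
move=> ij; apply/ffunP => k; rewrite !ffunE.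
by case: (eqVneq k j) => [->|//]; rewrite eq_sym (negbTE ij).
Qed.

Lemma update_id x i : update x i (x i) = x.
Proof. by apply/ffunP => j; rewrite ffunE; case: eqP => [->|]. Qed.

End Updates.

Section Resampling.
Context {R : realType} {q n : nat} {gamma : 'I_q -> R}.
Context (gamma_pmf : is_pmf gamma).
Local Notation X := {ffun 'I_n -> 'I_q}.
Implicit Types (f g : X -> R) (i j : 'I_n).

Lemma pmf_power_is_pmf : is_pmf (@pmf_power R q n gamma).
Proof.
split=> [x|]; first by apply: prodr_ge0 => i _; apply: gamma_pmf.1.
rewrite /pmf_power -(bigA_distr_bigA (fun (_ : 'I_n) u => gamma u)) /=.
by rewrite big1 // => i _; rewrite gamma_pmf.2.
Qed.

Definition coord_op (b : 'I_q -> R) (i : 'I_n) f : X -> R :=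
  fun x => \sum_u b u * f (update x i u).

Local Notation E := (mean (pmf_power gamma)).

Lemma pmf_power_update x i u :
  pmf_power gamma (update x i u) * gamma (x i) = pmf_power gamma x * gamma u.
Proof.
rewrite /pmf_power (bigD1 i) //= [in RHS](bigD1 i) //= update_same.
rewrite (eq_bigr (fun j => gamma (x j))) => [|j ji]; first by ring.
by rewrite ffunE (negbTE ji).
Qed.

(** The involution (x, u) |-> (x with x_i := u, x_i) preserves the product of
    [gamma^n] and [gamma]. *)
Lemma mean_resample i (H : X -> 'I_q -> R) :
  E (fun x => \sum_u gamma u * H (update x i u) (x i)) =
  E (fun x => \sum_u gamma u * H x u).
Proof.
rewrite /Defs.expectation_pmf.
under eq_bigr do rewrite mulr_sumr.
under [RHS]eq_bigr do rewrite mulr_sumr.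
rewrite !pair_bigA /=.
pose s (z : X * 'I_q) := (update z.1 i z.2, z.1 i).
have sK : involutive s.
  by move=> [x u]; rewrite /s /= update_update update_id update_same.
rewrite (reindex_inj (inv_inj sK)); apply: eq_bigr => -[x u] _ /=.
rewrite update_same update_update update_id !mulrA.
by rewrite pmf_power_update.
Qed.

Lemma mean_average i f : E (coord_op gamma i f) = E f.
Proof.
rewrite /coord_op (mean_resample i (fun y _ => f y)).
by apply: eq_bigr => x _; rewrite -mulr_suml gamma_pmf.2 mul1r.
Qed.

Lemma coord_op_comm b c i j f x : i != j ->
  coord_op b i (coord_op c j f) x = coord_op c j (coord_op b i f) x.
Proof.
move=> ij; rewrite /coord_op.
under eq_bigr do rewrite mulr_sumr.
under [RHS]eq_bigr do rewrite mulr_sumr.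
rewrite exchange_big; apply: eq_bigr => u _; apply: eq_bigr => v _.
by rewrite update_comm // mulrCA.
Qed.

End Resampling.

(** * Partially coupled pairs of points *)

Section Coupling.
Context {R : realType} {q n : nat} {gamma : 'I_q -> R}.
Context (gamma_pmf : is_pmf gamma).
Local Notation X := {ffun 'I_n -> 'I_q}.
Local Notation E := (mean (pmf_power gamma)).
Implicit Types (f g : X -> R) (W : X -> X -> R) (i j : 'I_n) (l : seq 'I_n).

Let pmfE : is_pmf (@pmf_power R q n gamma) := pmf_power_is_pmf gamma_pmf.

Definition tensor f g : X -> X -> R := fun x y => f x * g y.

(** Integrating the i-th pair of coordinates against the kernel [k]. *)
Definition pair_op (k : 'I_q -> 'I_q -> R) i W : X -> X -> R :=
  fun x y => \sum_u \sum_v k u v * W (update x i u) (update y i v).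

(** The expectation of [W (x, y)] when the pairs (x_j, y_j) are independent,
    with law [k j] if [j] is in [l] and law gamma x gamma otherwise. The
    recursion makes every tensorisation below an induction on [l]. *)
Fixpoint coupled (k : 'I_n -> 'I_q -> 'I_q -> R) l W : R :=
  if l is i :: l' then coupled k l' (pair_op (k i) i W)
  else E (fun x => E (fun y => W x y)).

Lemma coupled_le k l W W' : (forall i u v, 0 <= k i u v) ->
  (forall x y, W x y <= W' x y) -> coupled k l W <= coupled k l W'.
Proof.
move=> k0; elim: l W W' => [|i l IH] W W' WW' /=.
  by apply: (mean_le pmfE) => x; apply: (mean_le pmfE) => y.
apply: IH => x y; apply: ler_sum => u _; apply: ler_sum => v _.
by rewrite ler_wpM2l.
Qed.

Lemma eq_coupled k l W W' : (forall x y, W x y = W' x y) ->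
  coupled k l W = coupled k l W'.
Proof.
elim: l W W' => [|i l IH] W W' WW' /=.
  by apply: eq_mean => x; apply: eq_mean => y.
by apply: IH => x y; apply: eq_bigr => u _; apply: eq_bigr => v _; rewrite WW'.
Qed.

Lemma coupledZ k l c W : coupled k l (fun x y => c * W x y) = c * coupled k l W.
Proof.
elim: l W => [|i l IH] W /=.
  rewrite -meanZ; apply: eq_mean => x.
  by rewrite -meanZ; apply: eq_mean.
rewrite -IH; apply: eq_coupled => x y; rewrite /pair_op mulr_sumr.
by apply: eq_bigr => u _; rewrite mulr_sumr; apply: eq_bigr => v _; rewrite mulrCA.
Qed.

Lemma coupledD k l W W' :
  coupled k l (fun x y => W x y + W' x y) = coupled k l W + coupled k l W'.
Proof.
elim: l W W' => [|i l IH] W W' /=.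
  rewrite -meanD; apply: eq_mean => x.
  by rewrite -meanD; apply: eq_mean.
rewrite -IH; apply: eq_coupled => x y; rewrite /pair_op -big_split.
by apply: eq_bigr => u _; rewrite -big_split; apply: eq_bigr => v _; rewrite mulrDr.
Qed.

Lemma coupled_sum k l (I : finType) (W : I -> X -> X -> R) :
  coupled k l (fun x y => \sum_t W t x y) = \sum_t coupled k l (W t).
Proof.
elim: (index_enum I) => [|t s IH].
  rewrite big_nil (@eq_coupled _ _ _ (fun x y => 0 * 0)) => [|x y].
    by rewrite coupledZ mul0r.
  by rewrite big_nil mul0r.
rewrite big_cons -IH -coupledD; apply: eq_coupled => x y.
by rewrite big_cons.
Qed.

Lemma coupled_nil_tensor k f g : coupled k [::] (tensor f g) = E f * E g.
Proof.
rewrite /= mulrC -meanZ; apply: eq_mean => x.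
by rewrite /tensor meanZ mulrC.
Qed.

(** * Positively correlated couplings *)

Definition tilted (r : R) (a b : 'I_q -> R) (u v : 'I_q) : R :=
  gamma u * gamma v * (1 + r * (a u * b v)).

Definition slope_op (a : 'I_q -> R) : 'I_n -> (X -> R) -> X -> R :=
  coord_op (fun u => gamma u * a u).

Local Notation avg := (coord_op gamma).

(** The rank-one kernel preserves tensor products up to one correction term. *)
Lemma pair_op_tilted r a b i f g x y :
  pair_op (tilted r a b) i (tensor f g) x y =
  tensor (avg i f) (avg i g) x y + r * tensor (slope_op a i f) (slope_op b i g) x y.
Proof.
rewrite /tensor /slope_op /coord_op !big_distrlr /= mulr_sumr -big_split /=.
apply: eq_bigr => u _; rewrite mulr_sumr -big_split /=; apply: eq_bigr => v _.
rewrite /tilted; ring.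
Qed.

Lemma coupled_tilted_cons (r : 'I_n -> R) (a b : 'I_n -> 'I_q -> R) i l f g :
  let K j := tilted (r j) (a j) (b j) in
  coupled K (i :: l) (tensor f g) =
  coupled K l (tensor (avg i f) (avg i g)) +
  r i * coupled K l (tensor (slope_op (a i) i f) (slope_op (b i) i g)).
Proof.
move=> K; rewrite -coupledZ -coupledD /=; apply: eq_coupled => x y.
exact: pair_op_tilted.
Qed.

(** Two comparable events of probabilities s <= t have joint probability at most
    s under any coupling, which is their probability of intersection when x = y;
    events that are monotone in one coordinate are comparable. *)
Lemma pair_le_diagonal (k : 'I_q -> 'I_q -> R) (P Q : pred 'I_q) :
  (forall u v, 0 <= k u v) ->
  (forall u, \sum_v k u v = gamma u) -> (forall v, \sum_u k u v = gamma v) ->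
  (forall u v : 'I_q, (u <= v)%N -> P u -> P v) ->
  (forall u v : 'I_q, (u <= v)%N -> Q u -> Q v) ->
  \sum_u \sum_v k u v * ((P u)%:R * (Q v)%:R) <= \sum_u gamma u * ((P u)%:R * (Q u)%:R).
Proof.
move=> k0 kl kr mP mQ.
have [PQ|QP] : (forall u, P u -> Q u) \/ (forall u, Q u -> P u).
  have [/forallP h|/forallPn[u]] := boolP [forall u, P u ==> Q u].
    by left => u; apply/implyP.
  rewrite negb_imply => /andP[Pu nQu]; right => v Qv.
  have [uv|vu] := leqP u v; first exact: mP uv Pu.
  by have := mQ _ _ (ltnW vu) Qv; rewrite (negbTE nQu).
- apply: ler_sum => u _; rewrite -kl mulr_suml; apply: ler_sum => v _.
  apply: ler_wpM2l => //; case: (boolP (P u)) => [/PQ ->|_]; rewrite ?mul0r //.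
  by rewrite !mul1r; case: (Q v).
- rewrite exchange_big; apply: ler_sum => v _; rewrite -kr mulr_suml; apply: ler_sum => u _.
  apply: ler_wpM2l => //; case: (boolP (Q v)) => [/QP ->|_]; rewrite ?mulr0 //.
  by rewrite !mulr1; case: (P u).
Qed.

Definition increasing_pred (P : pred X) : Prop :=
  forall x i (u v : 'I_q), (u <= v)%N -> P (update x i u) -> P (update x i v).

Definition merge l x y : X := [ffun j => if j \in l then x j else y j].

(** In the bound, x and y are identified on the coordinates of [l] only; they are
    identified one coordinate at a time, by [pair_le_diagonal] on the fibers. *)
Lemma coupled_le_merge (k : 'I_n -> 'I_q -> 'I_q -> R) l (P Q : pred X) :
  (forall i u v, 0 <= k i u v) ->
  (forall i u, \sum_v k i u v = gamma u) -> (forall i v, \sum_u k i u v = gamma v) ->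
  increasing_pred P -> increasing_pred Q ->
  coupled k l (tensor (fun x => (P x)%:R) (fun x => (Q x)%:R)) <=
  E (fun x => E (fun y => (P x)%:R * (Q (merge l x y))%:R)).
Proof.
move=> k0 kl kr; elim: l P Q => [|i l IH] P Q mP mQ.
  apply: (mean_le pmfE) => x; apply: (mean_le pmfE) => y.
  by rewrite /tensor (_ : merge [::] x y = y) //; apply/ffunP => j; rewrite ffunE.
pose sec (S : pred X) u : pred X := fun x => S (update x i u).
have msec S u : increasing_pred S -> increasing_pred (sec S u).
  move=> mS x j v w vw; rewrite /sec.
  have [<-|ij] := eqVneq i j; first by rewrite !update_update.
  by rewrite !(@update_comm _ _ x j i) 1?eq_sym //; apply: mS.
pose T u := tensor (fun x => (sec P u x)%:R : R) (fun x => (sec Q u x)%:R).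
apply: (@le_trans _ _ (coupled k l (fun x y => \sum_u gamma u * T u x y))).
  rewrite [leLHS]/=; apply: coupled_le => // x y.
  (* x and y may differ in the other coordinates: the fiber of P through x is
     compared with the fiber of Q through y *)
  exact: (pair_le_diagonal (k0 i) (kl i) (kr i) (mP x i) (mQ y i)).
rewrite coupled_sum.
apply: (@le_trans _ _ (\sum_u gamma u *
    E (fun x => E (fun y => (sec P u x)%:R * (sec Q u (merge l x y))%:R)))).
  apply: ler_sum => u _; rewrite coupledZ ler_wpM2l ?gamma_pmf.1 //.
  exact/IH/msec/mQ/msec.
rewrite -(@mean_average R q n gamma gamma_pmf i).
rewrite /mean /coord_op.
under eq_bigr do rewrite -/(mean _ _) mulr_sumr.
under [leRHS]eq_bigr do rewrite mulr_sumr.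
rewrite exchange_big; apply: ler_sum => x _; apply: ler_sum => u _.
rewrite mulrCA !ler_wpM2l ?gamma_pmf.1 ?pmfE.1 //.
apply: (mean_le pmfE) => y; have -> : merge (i :: l) (update x i u) y = update (merge l x y) i u; last exact: lexx.
by apply/ffunP => j; rewrite !ffunE in_cons; case: eqP.
Qed.

Lemma coupled_le_diagonal (k : 'I_n -> 'I_q -> 'I_q -> R) l (P Q : pred X) :
  (forall i u v, 0 <= k i u v) ->
  (forall i u, \sum_v k i u v = gamma u) -> (forall i v, \sum_u k i u v = gamma v) ->
  increasing_pred P -> increasing_pred Q -> (forall i, i \in l) ->
  coupled k l (tensor (fun x => (P x)%:R) (fun x => (Q x)%:R)) <=
  E (fun x => (P x)%:R * (Q x)%:R).
Proof.
move=> k0 kl kr mP mQ lT; apply: le_trans (coupled_le_merge _ k0 kl kr mP mQ) _.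
apply: (mean_le pmfE) => x.
rewrite (@eq_mean _ _ _ _ (fun=> (P x)%:R * (Q x)%:R)) ?(mean_cst pmfE) // => y.
by congr (_ * (Q _)%:R); apply/ffunP => j; rewrite ffunE lT.
Qed.

(** * Tensorisation of reverse hypercontractivity *)

(** Borell's two-function form, written for the powers phi^s and psi^t of two
    functions: the left-hand side is then the product of the norms of phi^s and
    psi^t with exponents 1/s and 1/t. *)
Definition reverse_hypercontractive (k : 'I_q -> 'I_q -> R) (s t : R) : Prop :=
  forall phi psi : 'I_q -> R, (forall u, 0 <= phi u) -> (forall v, 0 <= psi v) ->
  mean gamma phi `^ s * mean gamma psi `^ t <=
  \sum_u \sum_v k u v * (phi u `^ s * psi v `^ t).

(** Applied to one pair of coordinates, the inequality leaves the powers of the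
    averages of phi and psi, to which it applies again; Jensen's inequality deals
    with the coordinates that are not coupled. *)
Lemma coupled_reverse_hypercontractive (k : 'I_n -> 'I_q -> 'I_q -> R) l s t phi psi :
  (forall (f : X -> R), (forall x, 0 <= f x) -> E f `^ s <= E (fun x => f x `^ s)) ->
  (forall (f : X -> R), (forall x, 0 <= f x) -> E f `^ t <= E (fun x => f x `^ t)) ->
  (forall i u v, 0 <= k i u v) ->
  (forall i, i \in l -> reverse_hypercontractive (k i) s t) ->
  (forall x, 0 <= phi x) -> (forall x, 0 <= psi x) ->
  E phi `^ s * E psi `^ t <=
  coupled k l (tensor (fun x => phi x `^ s) (fun x => psi x `^ t)).
Proof.
move=> Js Jt k0; elim: l phi psi => [|i l IH] phi psi kl phi0 psi0.
  by rewrite coupled_nil_tensor ler_pM ?powR_ge0 ?Js ?Jt.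
have avg0 f x : (forall x, 0 <= f x) -> 0 <= avg i f x.
  by move=> f0; apply: sumr_ge0 => u _; rewrite mulr_ge0 ?gamma_pmf.1.
rewrite -(mean_average gamma_pmf i phi) -(mean_average gamma_pmf i psi).
apply: le_trans (IH _ _ _ _ _) _ => [j jl|x|x|]; rewrite ?avg0 //.
  by apply: kl; rewrite in_cons jl orbT.
by apply: coupled_le => // x y; apply: kl; rewrite ?mem_head.
Qed.

End Coupling.

Arguments tilted {R q} gamma r a b u v.
Arguments slope_op {R q n} gamma a i f x.
Arguments coupled {R q n} gamma k l W.
Arguments reverse_hypercontractive {R q} gamma k s t.

(** * Reverse hypercontractivity for one pair of coordinates *)

Section ExpInequalities.
Context {R : realType}.
Implicit Types x y : R.

Lemma expR_le_quadratic y : expR y <= 1 + y + y ^+ 2 * expR `|y|.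
Proof.
(* e^y - 1 <= y e^y, which is multiplied by y below when y >= 0 *)
have h : expR y - 1 <= y * expR y.
  have := expR_ge1Dx (- y); rewrite expRN => h.
  have := ler_wpM2l (expR_ge0 y) h; rewrite divff ?gt_eqF ?expR_gt0 //; lra.
have [y0|y0] := leP 0 y.
  rewrite ger0_norm //; have := ler_wpM2l y0 h; lra.
have h1 := expR_ge1Dx y; have := @expR_ge1Dx R `|y|; rewrite ltr0_norm // => h2.
have := ler_wpM2l (sqr_ge0 y) h2; nra.
Qed.

Lemma inv1B_le_expR x : x <= 2^-1 -> - ln (1 - x) <= x + 2 * x ^+ 2.
Proof.
move=> xle; have x1 : 0 < 1 - x by lra.
rewrite -ler_expR expRN lnK ?posrE //; apply: le_trans (expR_ge1Dx _).
rewrite -[leLHS]mul1r ler_pdivrMr //; nra.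
Qed.

Lemma norm_le_sqr x : `|x| <= 8 + x ^+ 2 / 32.
Proof.
have [h|h] := leP 0 x; first rewrite ger0_norm //; last rewrite ltr0_norm //.
  by have := sqr_ge0 (x - 16); nra.
by have := sqr_ge0 (x + 16); nra.
Qed.

Lemma sqr_quartic_le_expR x : x ^+ 2 + x ^+ 4 <= 528 * expR (x ^+ 2 / 16).
Proof.
have s0 : 0 <= x ^+ 2 / 16 by rewrite divr_ge0 ?sqr_ge0.
have h1 := expR_ge1Dx (x ^+ 2 / 16); have := expR_ge1Dxn 1 s0.
rewrite (_ : 2`! = 2)%N // => h2.
have -> : x ^+ 4 = 256 * (x ^+ 2 / 16) ^+ 2 by field.
move: h1 h2; set s := x ^+ 2 / 16; have -> : x ^+ 2 = 16 * s by rewrite /s; field.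
by move=> h1 h2; move: s0; rewrite -/s; lra.
Qed.

End ExpInequalities.

Section Holder.
Context {R : realType} {T : finType} {p : T -> R}.
Context (p_pmf : is_pmf p).
Local Notation E := (mean p).

(** Hoelder's inequality with exponents 1 + e and (1 + e)/e, for the factors
    phi exp(- e z / (1 + e)) and exp(e z / (1 + e)). *)
Lemma mean_powR_le (phi z : T -> R) (e : R) : 0 < e -> (forall t, 0 <= phi t) ->
  E phi `^ (1 + e) <=
  E (fun t => phi t `^ (1 + e) * expR (- e * z t)) * E (fun t => expR (z t)) `^ e.
Proof.
move=> e0 phi0; set P := 1 + e.
have P0 : 0 < P by rewrite addr_gt0.
set S := E (fun t => _ * _); set U := E (fun t => expR (z t)).
have S0 : 0 <= S by apply: (mean_ge0 p_pmf) => t; rewrite mulr_ge0 ?powR_ge0 ?expR_ge0.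
have U0 : 0 < U.
  have [t pt] : exists t, 0 < p t.
    apply/existsP; apply: contraT => /existsPn h.
    have := p_pmf.2; rewrite big1 => [/esym/eqP|t _]; first by rewrite oner_eq0.
    by apply/eqP; rewrite eq_le p_pmf.1 andbT leNgt.
  apply: (@lt_le_trans _ _ (p t * expR (z t))); first by rewrite mulr_gt0 ?expR_gt0.
  rewrite /U /Defs.expectation_pmf (bigD1 t) //= lerDl sumr_ge0 // => u _.
  by rewrite mulr_ge0 ?p_pmf.1 ?expR_ge0.
have Ephi0 : 0 <= E phi by apply: (mean_ge0 p_pmf).
have [Seq0|Sneq0] := eqVneq S 0.
  suff -> : E phi = 0 by rewrite powR0 ?gt_eqF // Seq0 mul0r.
  apply: big1 => t _; have /eqP := Seq0.
  rewrite psumr_eq0 => [/allP/(_ t (mem_index_enum t))|u _] /=.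
    rewrite !mulf_eq0 expR_eq0 orbF powR_eq0.
    by case/orP => [/eqP ->|/andP[/eqP -> _]]; rewrite ?mul0r ?mulr0.
  by rewrite mulr_ge0 ?p_pmf.1 // mulr_ge0 ?powR_ge0 ?expR_ge0.
have Sp : 0 < S by rewrite lt_neqAle eq_sym Sneq0.
have Q0 : 0 < P / e by rewrite divr_gt0.
have PQ : P^-1 + (P / e)^-1 = 1 by rewrite /P; field; rewrite !gt_eqF.
pose N := S `^ P^-1 * U `^ (e / P).
have N0 : 0 < N by rewrite mulr_gt0 ?powR_gt0.
suff EN : E phi <= N.
  have := @ge0_ler_powR _ P (ltW P0) (E phi) N; rewrite !nnegrE => /(_ Ephi0 (ltW N0) EN).
  rewrite /N powRM ?powR_ge0 // -!powRrM mulVf ?gt_eqF // powRr1 //.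
  by rewrite divfK ?gt_eqF.
have key t : phi t / N <= (phi t `^ P * expR (- e * z t)) / (S * P) +
                          expR (z t) / (U * (P / e)).
  have := @conjugate_powR _ (phi t * expR (- e * z t / P) / S `^ P^-1)
     (expR (e * z t / P) / U `^ (e / P)) P (P / e).
  rewrite !divr_ge0 ?mulr_ge0 ?powR_ge0 ?expR_ge0 // => /(_ isT isT P0 Q0 PQ).
  rewrite -!powRN !powRM ?mulr_ge0 ?powR_ge0 ?expR_ge0 // -!expRM -!powRrM.
  have -> : - e * z t / P * P = - e * z t by field; rewrite gt_eqF.
  have -> : e * z t / P * (P / e) = z t by field; rewrite !gt_eqF.
  have -> : - P^-1 * P = - 1 by field; rewrite gt_eqF.
  have -> : - (e / P) * (P / e) = - 1 by field; rewrite !gt_eqF.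
  rewrite !powR_inv1 ?(ltW U0) // !powRN.
  have -> : phi t * expR (- e * z t / P) / S `^ P^-1 * (expR (e * z t / P) / U `^ (e / P)) =
            phi t / N.
    rewrite mulNr mulNr expRN /N; field.
    by rewrite !gt_eqF ?expR_gt0 ?powR_gt0.
  move=> h; apply: le_trans h _; rewrite le_eqVlt; apply/orP; left; apply/eqP; field.
  by rewrite !gt_eqF.
have h : E phi / N <= 1.
  have : E (fun t => N^-1 * phi t) <=
      E (fun t => (S * P)^-1 * (phi t `^ P * expR (- e * z t)) +
                  (U * (P / e))^-1 * expR (z t)).
    by apply: (mean_le p_pmf) => t; rewrite ![_^-1 * _]mulrC; exact: key.
  rewrite meanD !meanZ -/S -/U mulrC => h; apply: le_trans h _.
  rewrite le_eqVlt; apply/orP; left; apply/eqP; rewrite -[RHS]PQ; field.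
  by rewrite !gt_eqF.
by rewrite ler_pdivrMr ?mul1r in h.
Qed.

Lemma mean_powR_Jensen (phi : T -> R) (e : R) : 0 < e -> (forall t, 0 <= phi t) ->
  E phi `^ (1 + e) <= E (fun t => phi t `^ (1 + e)).
Proof.
move=> e0 phi0; have := mean_powR_le (fun=> 0) e0 phi0.
rewrite expR0 (mean_cst p_pmf) powR1 mulr1 => h; apply: le_trans h _.
by apply: (mean_le p_pmf) => t; rewrite mulr0 expR0 mulr1.
Qed.

End Holder.

Section ReverseHypercontractivity.
Context {R : realType} {q : nat} {gamma : 'I_q -> R}.
Context (gamma_pmf : is_pmf gamma).
Local Notation E := (mean gamma).
Implicit Types (a b phi psi : 'I_q -> R) (K m e d r : R).

(** The bound on E[exp(a^2 / 8)] is the quantitative part; [m] only enters through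
    the size of the admissible correlations. *)
Record subgaussian (K m : R) (a : 'I_q -> R) : Prop := Subgaussian {
  subgaussian_mean0 : E a = 0;
  subgaussian_bound : forall u, `|a u| <= m;
  subgaussian_exp : E (fun u => expR (a u ^+ 2 / 8)) <= K }.

(** The constant of the second order expansion in [subgaussian_mgf]. *)
Definition mgf_const (K : R) : R := (16 + 1056 * expR 8) * K.

Lemma mgf_const_ge4 K : 1 <= K -> 4 + K <= mgf_const K.
Proof.
move=> K1; have := expR_gt0 (8 : R); rewrite /mgf_const; nra.
Qed.

(** For small [l] a second order expansion, whose linear term vanishes in the
    mean; for large [l] the bound l x <= 4 l^2 + x^2 / 16. *)
Lemma subgaussian_mgf K m a l nu : 1 <= K -> subgaussian K m a ->
  0 <= nu -> nu <= 32^-1 -> nu <= 2 * l ^+ 2 ->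
  E (fun u => expR (l * a u + nu * a u ^+ 2)) <= expR (mgf_const K * l ^+ 2).
Proof.
move=> K1 [a0 _ aK] nu0 nu32 nul.
have [l1|l1] := leP (l ^+ 2) 1; last first.
  apply: (@le_trans _ _ (expR (4 * l ^+ 2) * K)).
    apply: (@le_trans _ _ (E (fun u => expR (4 * l ^+ 2) * expR (a u ^+ 2 / 8)))).
      apply: (mean_le gamma_pmf) => u; rewrite -expRD ler_expR.
      have h := sqr_ge0 (8 * l - a u); have h2 := sqr_ge0 (a u); nra.
    by rewrite meanZ ler_wpM2l ?expR_ge0.
  have -> : K = expR (ln K) by rewrite lnK // posrE (lt_le_trans ltr01).
  rewrite -expRD ler_expR lnK ?posrE ?(lt_le_trans ltr01) //.
  have lnKK : ln K <= K by rewrite ltW // ln_sublinear // (lt_le_trans ltr01).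
  have := mgf_const_ge4 K1; nra.
have [c c0 [cE cK]] : exists2 c : R, 0 <= c & c = 16 + 1056 * expR 8 /\ mgf_const K = c * K.
  exists (16 + 1056 * expR 8); last by split; reflexivity.
  have := expR_ge0 (8 : R); lra.
apply: (@le_trans _ _ (1 + c * l ^+ 2 * K)); last first.
  by apply: le_trans (expR_ge1Dx _); rewrite lerD2l cK mulrAC.
apply: (@le_trans _ _ (E (fun u => 1 + l * a u + c * l ^+ 2 * expR (a u ^+ 2 / 8)))); last first.
  by rewrite (mean_affine gamma_pmf) a0 mulr0 addr0 lerD2l ler_wpM2l // mulr_ge0 ?sqr_ge0.
apply: (mean_le gamma_pmf) => u; set x := a u.
apply: le_trans (expR_le_quadratic _) _.
have x20 := sqr_ge0 x; have l20 := sqr_ge0 l.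
have E1 : 1 + x ^+ 2 / 8 <= expR (x ^+ 2 / 8) by exact: expR_ge1Dx.
have Y2 : (l * x + nu * x ^+ 2) ^+ 2 <= 2 * l ^+ 2 * (x ^+ 2 + x ^+ 4).
  have h := sqr_ge0 (l * x - nu * x ^+ 2).
  have nu2 : nu ^+ 2 <= l ^+ 2 by nra.
  have h2 : nu ^+ 2 * x ^+ 4 <= l ^+ 2 * x ^+ 4 by rewrite ler_wpM2r // (exprM x 2 2) sqr_ge0.
  nra.
have Yabs : `|l * x + nu * x ^+ 2| <= 8 + x ^+ 2 / 16.
  apply: le_trans (ler_normD _ _) _.
  have -> : `|nu * x ^+ 2| = nu * x ^+ 2 by rewrite ger0_norm // mulr_ge0.
  rewrite (normrM l x).
  have lx : `|l| <= 1 by rewrite -(@ler_pXn2r _ 2) ?nnegrE // expr1n real_normK ?num_real.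
  have h := norm_le_sqr x; have h2 := normr_ge0 x; nra.
have E2 : expR `|l * x + nu * x ^+ 2| <= expR 8 * expR (x ^+ 2 / 16).
  by rewrite -expRD ler_expR.
have E3 : expR (x ^+ 2 / 16) * expR (x ^+ 2 / 16) = expR (x ^+ 2 / 8).
  by rewrite -expRD; congr expR; field.
have E4 := sqr_quartic_le_expR x.
rewrite {}cE.
have nux : nu * x ^+ 2 <= 16 * l ^+ 2 * expR (x ^+ 2 / 8) by nra.
have : (l * x + nu * x ^+ 2) ^+ 2 * expR `|l * x + nu * x ^+ 2| <=
  1056 * expR 8 * l ^+ 2 * expR (x ^+ 2 / 8).
  apply: (@le_trans _ _ ((2 * l ^+ 2 * (528 * expR (x ^+ 2 / 16))) *
      (expR 8 * expR (x ^+ 2 / 16)))).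
    rewrite ler_pM ?sqr_ge0 ?expR_ge0 //; apply: le_trans Y2 _.
    by rewrite ler_wpM2l // mulr_ge0.
  rewrite -E3 le_eqVlt; apply/orP; left; apply/eqP; ring.
lra.
Qed.

(** Hoelder's inequality against the weight 1 - eta a: tilting the density
    [phi^(1 + e)] towards [-a] lowers its mass by eta E[a phi^(1 + e)], at a price
    of second order in eta. *)
Lemma mean_powR_tilt K m a phi e eta : 1 <= K -> subgaussian K m a ->
  (forall u, 0 <= phi u) -> 0 < e <= 1 -> `|eta| * m <= 2^-1 -> eta ^+ 2 <= e / 64 ->
  E phi `^ (1 + e) <=
  (E (fun u => phi u `^ (1 + e)) - eta * E (fun u => a u * phi u `^ (1 + e))) *
  expR (mgf_const K * eta ^+ 2 / e).
Proof.
move=> K1 aS phi0 /andP[e0 e1] etam eta64; have [a0 am _] := aS.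
have etaa u : eta * a u <= 2^-1.
  apply: le_trans (ler_norm _) _; rewrite normrM; apply: le_trans etam.
  by rewrite ler_wpM2l.
have pos u : 0 < 1 - eta * a u by have := etaa u; lra.
pose z u := - ln (1 - eta * a u) / e.
apply: le_trans (mean_powR_le gamma_pmf z e0 phi0) _.
apply: ler_pM; rewrite ?powR_ge0 //.
- by apply: (mean_ge0 gamma_pmf) => u; rewrite mulr_ge0 ?powR_ge0 ?expR_ge0.
- rewrite -meanZ -meanB le_eqVlt; apply/orP; left; apply/eqP; apply: eq_mean => u.
  have -> : - e * z u = ln (1 - eta * a u) by rewrite /z; field; rewrite gt_eqF.
  by rewrite lnK ?posrE //; ring.
have -> : mgf_const K * eta ^+ 2 / e = mgf_const K * (eta / e) ^+ 2 * e.
  by field; rewrite gt_eqF.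
rewrite expRM; apply: ge0_ler_powR; rewrite ?(ltW e0) ?nnegrE ?expR_ge0 //.
  by apply: (mean_ge0 gamma_pmf) => u; rewrite expR_ge0.
have nuE : eta ^+ 2 / e <= (eta / e) ^+ 2.
  rewrite expr_div_n ler_wpM2l ?sqr_ge0 // lef_pV2 ?posrE ?exprn_gt0 //.
  by rewrite expr2 ler_piMr // ltW.
apply: le_trans (subgaussian_mgf (nu := 2 * eta ^+ 2 / e) K1 aS _ _ _).
- apply: (mean_le gamma_pmf) => u; rewrite ler_expR /z.
  rewrite (_ : eta / e * a u + _ = (eta * a u + 2 * (eta * a u) ^+ 2) / e).
    by rewrite ler_pM2r ?invr_gt0 // inv1B_le_expR.
  by field; rewrite gt_eqF.
- by apply: divr_ge0; [rewrite mulr_ge0 ?sqr_ge0|exact: ltW].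
- by rewrite ler_pdivrMr //; lra.
- by rewrite -mulrA ler_wpM2l.
Qed.

(** With eta = mu / (2 C) and C = [mgf_const K], the exponent - tau eta + C eta^2 / e
    that comes from [mean_powR_tilt] is at most - tau mu / (4 C) when mu <= e tau. *)
Definition rhc_const (K : R) : R := (4 * mgf_const K)^-1.

Lemma rhc_const_gt0 K : 1 <= K -> 0 < rhc_const K.
Proof. by move=> K1; have h := mgf_const_ge4 K1; rewrite /rhc_const invr_gt0; lra. Qed.

Lemma rhc_const_le1 K : 1 <= K -> rhc_const K <= 1.
Proof. by move=> K1; have h := mgf_const_ge4 K1; rewrite /rhc_const invf_le1; lra. Qed.

(** The previous bound with the best admissible [eta], of order
    min(e tau, 1/m) where tau = |E[a f]| / E f and f = phi^(1 + e). *)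
Lemma mean_powR_gain K m a phi e tau : 1 <= K -> 0 < m -> subgaussian K m a ->
  (forall u, 0 <= phi u) -> 0 < e <= 1 -> 0 <= tau ->
  let f u := phi u `^ (1 + e) in
  `|E (fun u => a u * f u)| = tau * E f -> tau <= m ->
  E phi `^ (1 + e) <= E f * expR (- (rhc_const K * (tau * Num.min (e * tau) m^-1))).
Proof.
move=> K1 m0 aS phi0 e01 tau0 f tauE taum; have /andP[e0 e1] := e01.
set C := mgf_const K; have C5 : 5 <= C by have := mgf_const_ge4 K1; rewrite -/C; lra.
have C0 : 0 < C by lra.
set mu := Num.min _ _.
have mu0 : 0 <= mu by rewrite le_min mulr_ge0 ?(ltW e0) // invr_ge0 ltW.
have mu1 : mu <= e * tau by rewrite ge_min lexx.
have mu2 : mu <= m^-1 by rewrite ge_min lexx orbT.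
pose k := (2 * C)^-1.
have k0 : 0 < k by rewrite invr_gt0 mulr_gt0.
have kC : C * k = 2^-1 by rewrite /k; field; rewrite gt_eqF.
have k1 : k <= 10^-1 by nra.
have Ck : rhc_const K = k / 2 by rewrite /rhc_const -/C /k; field; rewrite gt_eqF.
have mum : mu * m <= 1 by rewrite -ler_pdivlMr // div1r.
have musq : mu ^+ 2 <= e.
  apply: (@le_trans _ _ (e * tau * m^-1)); first by rewrite expr2 ler_pM.
  by rewrite -mulrA ler_piMr ?(ltW e0) // ler_pdivrMr // mul1r.
pose s : R := if 0 <= E (fun u => a u * f u) then 1 else -1.
have s1 : `|s| = 1 by rewrite /s; case: ifP; rewrite ?normrN normr1.
have sE : s * E (fun u => a u * f u) = tau * E f.
  rewrite -tauE /s; have [h|h] := leP 0 (E (fun u => a u * f u)).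
    by rewrite mul1r ger0_norm.
  by rewrite mulN1r ltr0_norm.
have f0 : 0 <= E f by apply: (mean_ge0 gamma_pmf) => u; rewrite powR_ge0.
have eta2 : (s * (k * mu)) ^+ 2 = (k * mu) ^+ 2.
  by rewrite -[LHS]real_normK ?num_real // normrM s1 mul1r real_normK ?num_real.
apply: le_trans (mean_powR_tilt (eta := s * (k * mu)) K1 aS phi0 e01 _ _) _.
- rewrite normrM s1 mul1r ger0_norm ?mulr_ge0 ?(ltW k0) //; nra.
- have k2 : k ^+ 2 <= 100^-1 by nra.
  rewrite eta2 exprMn; have := ler_wpM2r (sqr_ge0 mu) k2; lra.
rewrite -/f mulrAC sE eta2.
have -> : E f - tau * E f * (k * mu) = E f * (1 - tau * (k * mu)) by ring.
rewrite -mulrA ler_wpM2l //.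
apply: (@le_trans _ _ (expR (- (tau * (k * mu))) * expR (C * (k * mu) ^+ 2 / e))).
  by rewrite ler_wpM2r ?expR_ge0 // expR_ge1Dx.
rewrite -expRD ler_expR Ck.
have : (k * mu) ^+ 2 / e <= k ^+ 2 * (mu * tau).
  rewrite exprMn -mulrA ler_wpM2l ?sqr_ge0 // ler_pdivrMr // expr2 -mulrA ler_wpM2l //.
  by rewrite mulrC.
move=> /(ler_wpM2l (ltW C0)).
have -> : C * (k ^+ 2 * (mu * tau)) = C * k * (k * (mu * tau)) by ring.
rewrite kC mulrA; lra.
Qed.

Lemma expRN2_le x : 0 <= x <= 2^-1 -> expR (- (2 * x)) <= 1 - x :> R.
Proof.
move=> /andP[x0 x1]; rewrite expRN -[leLHS]mul1r ler_pdivrMr ?expR_gt0 //.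
have := expR_ge1Dx (2 * x); nra.
Qed.

(** Tilting gains exp(- c (X + Y)) on the product of the two powers, while the
    coupling loses at most the factor 1 - r tau sigma; the hypotheses on [r] make
    the gain dominate, by the arithmetic-geometric mean inequality when neither
    bound [m1], [m2] is binding. *)
Lemma tilted_reverse_hypercontractive K m1 m2 a b r e d :
  1 <= K -> 0 < m1 -> 0 < m2 -> subgaussian K m1 a -> subgaussian K m2 b ->
  0 < e <= 1 -> 0 < d <= 1 -> 0 <= r ->
  2 * r * (m1 * m2) <= rhc_const K -> (2 * r) ^+ 2 <= rhc_const K ^+ 2 * (e * d) ->
  reverse_hypercontractive gamma (tilted gamma r a b) (1 + e) (1 + d).
Proof.
move=> K1 m10 m20 aS bS e01 d01 r0 rm red phi psi phi0 psi0.
have /andP[e0 e1] := e01; have /andP[d0 d1] := d01.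
pose f u := phi u `^ (1 + e); pose g u := psi u `^ (1 + d).
have -> : \sum_u \sum_v tilted gamma r a b u v * (phi u `^ (1 + e) * psi v `^ (1 + d)) =
    E f * E g + r * (E (fun u => a u * f u) * E (fun u => b u * g u)).
  rewrite /Defs.expectation_pmf !big_distrlr /= mulr_sumr -big_split /=.
  apply: eq_bigr => u _; rewrite mulr_sumr -big_split /=; apply: eq_bigr => v _.
  rewrite /tilted /f /g; ring.
have posc := rhc_const_gt0 K1; have cle := rhc_const_le1 K1.
have ratio (c h : 'I_q -> R) m : 0 < m -> (forall u, `|c u| <= m) -> (forall u, 0 <= h u) ->
    exists2 t, 0 <= t <= m & `|E (fun u => c u * h u)| = t * E h.
  move=> m0 cm h0; have Eh := mean_ge0 gamma_pmf h0.
  have le : `|E (fun u => c u * h u)| <= m * E h.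
    apply: le_trans (mean_norm gamma_pmf _) _; rewrite -meanZ.
    by apply: (mean_le gamma_pmf) => u; rewrite normrM (ger0_norm (h0 u)) ler_wpM2r.
  have [Eh0|Ehn] := eqVneq (E h) 0.
    exists 0; first by rewrite lexx ltW.
    apply/eqP; rewrite mul0r eq_le normr_ge0 andbT.
    by move: le; rewrite Eh0 mulr0.
  have Ehp : 0 < E h by rewrite lt_neqAle eq_sym Ehn.
  exists (`|E (fun u => c u * h u)| / E h); last by rewrite divfK.
  by rewrite divr_ge0 //= ler_pdivrMr.
have [t /andP[t0 tm] tE] := ratio a f m1 m10 (subgaussian_bound aS) (fun u => powR_ge0 _ _).
have [s /andP[s0 sm] sE] := ratio b g m2 m20 (subgaussian_bound bS) (fun u => powR_ge0 _ _).
have h1 := mean_powR_gain K1 m10 aS phi0 e01 t0 tE tm.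
have h2 := mean_powR_gain K1 m20 bS psi0 d01 s0 sE sm.
have f0 : 0 <= E f by apply: (mean_ge0 gamma_pmf) => u; rewrite powR_ge0.
have g0 : 0 <= E g by apply: (mean_ge0 gamma_pmf) => u; rewrite powR_ge0.
apply: le_trans (ler_pM (powR_ge0 _ _) (powR_ge0 _ _) h1 h2) _; rewrite -/f -/g.
set c := rhc_const K in rm red posc cle *.
set X := t * _; set Y := s * _.
have ts0 : 0 <= t * s by rewrite mulr_ge0.
have X0 : 0 <= X by rewrite mulr_ge0 // le_min mulr_ge0 ?(ltW e0) // invr_ge0 ltW.
have Y0 : 0 <= Y by rewrite mulr_ge0 // le_min mulr_ge0 ?(ltW d0) // invr_ge0 ltW.
have main : 2 * (r * (t * s)) <= c * (X + Y).
  have rs : 2 * r * m1 * m2 <= c by rewrite -mulrA.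
  have rt0 : 0 <= r * t by rewrite mulr_ge0.
  have rs0 : 0 <= r * s by rewrite mulr_ge0.
  rewrite /X /Y /Num.min; case: ltP => [c1|c1]; last first.
    apply: (@le_trans _ _ (c * (t / m1))); last by rewrite ler_wpM2l ?(ltW posc) // lerDl.
    rewrite [leRHS]mulrA ler_pdivlMr //; have : r * t * s <= r * t * m2 by rewrite ler_wpM2l.
    have := ler_wpM2r t0 rs; nra.
  case: ltP => [c2|c2]; last first.
    apply: (@le_trans _ _ (c * (s / m2))); last by rewrite ler_wpM2l ?(ltW posc) // lerDr !mulr_ge0 // ltW.
    rewrite [leRHS]mulrA ler_pdivlMr //; have : r * s * t <= r * s * m1 by rewrite ler_wpM2l.
    have := ler_wpM2r s0 rs; nra.
  have te0 : 0 <= t * (e * t) by rewrite !mulr_ge0 // ltW.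
  have sd0 : 0 <= s * (d * s) by rewrite !mulr_ge0 // ltW.
  have L0 : 0 <= 2 * (r * (t * s)) by rewrite !mulr_ge0.
  have R0 : 0 <= c * (t * (e * t) + s * (d * s)) by rewrite mulr_ge0 ?(ltW posc) ?addr_ge0.
  rewrite -(@ler_pXn2r _ 2) ?nnegrE //.
  apply: (@le_trans _ _ (c ^+ 2 * (e * d) * (t * s) ^+ 2)).
    by rewrite mulrA exprMn ler_wpM2r ?sqr_ge0.
  have -> : c ^+ 2 * (e * d) * (t * s) ^+ 2 = c ^+ 2 * ((t * (e * t)) * (s * (d * s))) by ring.
  rewrite exprMn ler_wpM2l ?sqr_ge0 //; nra.
have half : r * (t * s) <= 2^-1.
  have : r * (t * s) <= r * (m1 * m2) by rewrite ler_wpM2l // ler_pM.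
  lra.
apply: (@le_trans _ _ (E f * E g * (1 - r * (t * s)))).
  rewrite mulrACA -expRD ler_wpM2l ?mulr_ge0 //; apply: le_trans (expRN2_le _).
    by rewrite ler_expR; rewrite mulrDr in main; lra.
  by rewrite half mulr_ge0.
rewrite mulrBr mulr1 lerD2l.
have -> : E f * E g * (r * (t * s)) = r * ((t * E f) * (s * E g)) by ring.
rewrite -tE -sE -normrM -mulrN ler_wpM2l //.
by rewrite lerNl; have := ler_norm (- (E (fun u => a u * f u) * E (fun u => b u * g u))); rewrite normrN.
Qed.

End ReverseHypercontractivity.

Section SmallMoments.
Context {R : realType} {T : finType} {p : T -> R}.
Context (p_pmf : is_pmf p).
Local Notation E := (mean p).

(** Truncating [F] at the level t = 2 E[F^2] / E F keeps half of its mean, and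
    F <= t^(e/(1+e)) F^(1/(1+e)) below that level. *)
Lemma mean_powR_moment (F : T -> R) (e : R) : 0 < e <= 1 -> (forall t, 0 <= F t) ->
  E F / 8 * (E F ^+ 2 / E (fun t => F t ^+ 2)) `^ e <=
  E (fun t => F t `^ (1 + e)^-1) `^ (1 + e).
Proof.
move=> /andP[e0 e1] F0; set V := E (fun t => F t ^+ 2).
have EF0 : 0 <= E F := mean_ge0 p_pmf F0.
have [->|EFn] := eqVneq (E F) 0; first by rewrite !mul0r powR_ge0.
have EFp : 0 < E F by rewrite lt_neqAle eq_sym EFn.
have V0 : 0 < V.
  by apply: lt_le_trans (mean_sqr_le p_pmf F); rewrite exprn_gt0.
have P0 : 0 < 1 + e by rewrite addr_gt0.
set M := E (fun t => F t `^ _).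
have M0 : 0 <= M by apply: (mean_ge0 p_pmf) => t; rewrite powR_ge0.
pose s := 2 * V / E F; have s0 : 0 < s by rewrite divr_gt0 ?mulr_gt0.
pose al := e / (1 + e); have al0 : 0 < al by rewrite divr_gt0.
have alE : al + (1 + e)^-1 = 1 by rewrite /al; field; rewrite gt_eqF.
have key u : 0 <= u -> u <= s `^ al * u `^ (1 + e)^-1 + s^-1 * u ^+ 2.
  move=> u0; have [us|su] := leP u s; last first.
    apply: (@le_trans _ _ (s^-1 * u ^+ 2)); last by rewrite lerDr mulr_ge0 ?powR_ge0.
    by rewrite mulrC ler_pdivlMr // expr2 ler_wpM2l // ltW.
  apply: (@le_trans _ _ (s `^ al * u `^ (1 + e)^-1)); last first.
    by rewrite lerDl mulr_ge0 ?sqr_ge0 // invr_ge0 ltW.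
  have uE : u = u `^ al * u `^ (1 + e)^-1.
    by rewrite -powRD ?alE ?powRr1 // oner_eq0.
  by rewrite {1}uE ler_wpM2r ?powR_ge0 // ge0_ler_powR ?nnegrE // ltW.
have hM : E F / 2 <= s `^ al * M.
  have : E F <= E (fun t => s `^ al * F t `^ (1 + e)^-1 + s^-1 * F t ^+ 2).
    by apply: (mean_le p_pmf) => t; apply: key.
  rewrite meanD !meanZ -/M -/V.
  have -> : s^-1 * V = E F / 2 by rewrite /s; field; rewrite !gt_eqF.
  lra.
have hM2 : (E F / 2) `^ (1 + e) <= s `^ e * M `^ (1 + e).
  apply: le_trans (ge0_ler_powR _ _ _ hM) _; rewrite ?nnegrE ?divr_ge0 ?mulr_ge0 ?powR_ge0 //.
    exact: ltW.
  by rewrite powRM ?powR_ge0 // -powRrM divfK ?gt_eqF.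
have hs : 0 < s `^ e by rewrite powR_gt0.
rewrite -(ler_pM2l hs); apply: le_trans hM2.
have EF2 : 0 < E F / 2 by rewrite divr_gt0.
rewrite powRD; last by rewrite gt_eqF.
rewrite powRr1 ?(ltW EF2) //.
have -> : (E F / 2) `^ e = s `^ e * (E F ^+ 2 / V) `^ e * (4^-1) `^ e.
  rewrite -!powRM ?divr_ge0 ?mulr_ge0 ?sqr_ge0 ?(ltW s0) ?(ltW V0) //.
    by congr (_ `^ _); rewrite /s; field; rewrite !gt_eqF.
  by rewrite invr_ge0 ltW.
  by rewrite invr_ge0 ltW.
have h4 : 4^-1 <= (4^-1 : R) `^ e.
  rewrite -[leLHS]powRr1; last by rewrite invr_ge0.
  by apply: ger_powR => //; lra.
rewrite [leLHS](_ : _ = E F / 2 * (s `^ e * (E F ^+ 2 / V) `^ e * 4^-1)); last by field.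
by rewrite ler_wpM2l ?(ltW EF2) // ler_wpM2l // mulr_ge0 ?powR_ge0.
Qed.

End SmallMoments.

(** * Increasing functions and the decomposition of the covariance *)

Section Decomposition.
Context {R : realType} {q n : nat} {gamma : 'I_q -> R}.
Context (gamma_pmf : is_pmf gamma).
Local Notation X := {ffun 'I_n -> 'I_q}.
Local Notation E := (mean (pmf_power gamma)).
Local Notation avg := (coord_op gamma).
Local Notation slope := (slope_op gamma).
Implicit Types (f g : X -> R) (i j : 'I_n) (l : seq 'I_n) (a b : 'I_n -> 'I_q -> R).

Let pmfE : is_pmf (@pmf_power R q n gamma) := pmf_power_is_pmf gamma_pmf.

Definition coord_increasing f : Prop :=
  forall x i (u v : 'I_q), (u <= v)%N -> f (update x i u) <= f (update x i v).

Lemma increasing_avg i f : coord_increasing f -> coord_increasing (avg i f).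
Proof.
move=> mf x j u v uv; apply: ler_sum => w _; rewrite ler_wpM2l ?gamma_pmf.1 //.
have [->|ij] := eqVneq j i; first by rewrite !update_update.
by rewrite !(@update_comm _ _ x j i) //; apply: mf.
Qed.

(** Chebyshev's correlation inequality in one coordinate. *)
Lemma slope_ge0 (c : 'I_q -> R) i f x : mean gamma c = 0 ->
  (forall u v : 'I_q, (u <= v)%N -> c u <= c v) -> coord_increasing f ->
  0 <= slope c i f x.
Proof.
move=> c0 mc mf; pose h u := f (update x i u).
have -> : slope c i f x = mean gamma (fun u => c u * h u).
  by apply: eq_bigr => u _; rewrite mulrA.
have key : 0 <= \sum_u \sum_v gamma u * gamma v * ((c u - c v) * (h u - h v)).
  apply: sumr_ge0 => u _; apply: sumr_ge0 => v _.
  apply: mulr_ge0; first by rewrite mulr_ge0 ?gamma_pmf.1.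
  have [uv|/ltnW vu] := leqP u v.
    by rewrite mulr_le0 // subr_le0 ?mc //; apply: mf.
  by rewrite mulr_ge0 // subr_ge0 ?mc //; apply: mf.
suff kE : \sum_u \sum_v gamma u * gamma v * ((c u - c v) * (h u - h v)) =
    2 * mean gamma (fun u => c u * h u).
  by move: key; rewrite kE pmulr_rge0.
have -> : 2 * mean gamma (fun u => c u * h u) =
  mean gamma (fun u => c u * h u) * mean gamma (fun=> 1) +
  mean gamma (fun=> 1) * mean gamma (fun u => c u * h u) -
  (mean gamma c * mean gamma h + mean gamma h * mean gamma c).
  by rewrite c0 !(mean_cst gamma_pmf); ring.
rewrite /Defs.expectation_pmf !big_distrlr /= -!big_split -sumrB /=.
apply: eq_bigr => u _; rewrite -!big_split -sumrB /=.
by apply: eq_bigr => v _; ring.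
Qed.

Lemma mean_slope_avg (c : 'I_q -> R) i j f : i != j ->
  E (slope c i (avg j f)) = E (slope c i f).
Proof.
move=> ij; rewrite -[RHS](mean_average gamma_pmf j); apply: eq_mean => x.
exact: coord_op_comm.
Qed.

(** Bessel's inequality in one coordinate, [c] being orthogonal to constants. *)
Lemma slope_sqr_le (c : 'I_q -> R) v i f : mean gamma c = 0 ->
  mean gamma (fun u => c u ^+ 2) <= v ->
  E (fun x => slope c i f x ^+ 2) <=
  v * (E (fun x => f x ^+ 2) - E (fun x => avg i f x ^+ 2)).
Proof.
move=> c0 cv.
rewrite -[X in v * (X - _)](mean_average gamma_pmf i) -meanB -meanZ.
apply: (mean_le pmfE) => x; pose h u := f (update x i u).
pose m := avg i f x; have mE : mean gamma h = m by [].
have -> : slope c i f x = mean gamma (fun u => c u * (h u - m)).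
  rewrite [RHS](@eq_mean _ _ _ _ (fun u => c u * h u - m * c u)) => [|u]; last by ring.
  rewrite meanB meanZ c0 mulr0 subr0.
  by apply: eq_bigr => u _; rewrite mulrA.
apply: le_trans (mean_CauchySchwarz gamma_pmf _ _) _.
have -> : avg i (fun x => f x ^+ 2) x - avg i f x ^+ 2 = mean gamma (fun u => (h u - m) ^+ 2).
  rewrite [RHS](@eq_mean _ _ _ _ (fun u => h u ^+ 2 - (2 * m * h u - m ^+ 2 * 1))) => [|u].
    rewrite meanB (meanB (fun u => 2 * m * h u)) !meanZ (mean_cst gamma_pmf) mE -/m.
    by rewrite /Defs.expectation_pmf /coord_op; ring.
  by ring.
by rewrite ler_wpM2r //; apply: (mean_ge0 gamma_pmf) => u; rewrite sqr_ge0.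
Qed.

Lemma mean_avg_sqr_le i f : E (fun x => avg i f x ^+ 2) <= E (fun x => f x ^+ 2).
Proof.
rewrite -[leRHS](mean_average gamma_pmf i); apply: (mean_le pmfE) => x.
exact: (mean_sqr_le gamma_pmf (fun u => f (update x i u))).
Qed.

(** Averaging out the coordinates of [l] one after the other decomposes [f] into
    orthogonal increments, of which these are the squared coefficients along [a]. *)
Fixpoint energy a l f : R :=
  if l is i :: l' then E (fun x => slope (a i) i f x ^+ 2) + energy a l' (avg i f)
  else 0.

Lemma energy_le a v l f : 0 <= v -> (forall i, mean gamma (a i) = 0) ->
  (forall i, mean gamma (fun u => a i u ^+ 2) <= v) ->
  energy a l f <= v * (E (fun x => f x ^+ 2) - E f ^+ 2).
Proof.
move=> v0 a0 av; elim: l f => [|i l IH] f /=.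
  by rewrite mulr_ge0 // subr_ge0 mean_sqr_le.
apply: le_trans (lerD (slope_sqr_le i f (a0 i) (av i)) (IH (avg i f))) _.
rewrite (mean_average gamma_pmf); lra.
Qed.

Lemma sum_mean_slope_sqr_le a v l f : uniq l -> 0 <= v ->
  (forall i, mean gamma (a i) = 0) -> (forall i, mean gamma (fun u => a i u ^+ 2) <= v) ->
  \sum_(i <- l) E (slope (a i) i f) ^+ 2 <= v * (E (fun x => f x ^+ 2) - E f ^+ 2).
Proof.
move=> ul v0 a0 av; apply: le_trans (energy_le l f v0 a0 av).
elim: l f ul => [|i l IH] f; first by rewrite big_nil.
move=> /= /andP[il ul]; rewrite big_cons lerD ?mean_sqr_le //.
apply: le_trans (IH (avg i f) ul); rewrite big_seq_cond [leRHS]big_seq_cond.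
apply: ler_sum => j; rewrite andbT => jl; rewrite mean_slope_avg //.
by apply: contraNneq il => <-.
Qed.

Section Gains.
Context (r : 'I_n -> R) (a b : 'I_n -> 'I_q -> R).
Let K j := tilted gamma (r j) (a j) (b j).

(** The total gain when the coordinates of [l] are correlated, the last one first:
    in the term of [i] the coordinates after [i] are already coupled, and those
    before it have been averaged out. *)
Fixpoint gains l f g : R :=
  if l is i :: l' then
    r i * coupled gamma K l' (tensor (slope (a i) i f) (slope (b i) i g)) +
    gains l' (avg i f) (avg i g)
  else 0.

Lemma coupled_gains l f g : coupled gamma K l (tensor f g) = E f * E g + gains l f g.
Proof.
elim: l f g => [|i l IH] f g; first by rewrite coupled_nil_tensor addr0.
by rewrite coupled_tilted_cons -/K IH !(mean_average gamma_pmf) /= addrAC addrA.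
Qed.

(** The joint probability of two increasing events exceeds the independent one by
    the gains when the points are coupled, and it is largest for equal points. *)
Lemma covariance_ge_gains l (P Q : pred X) :
  (forall i u v, 0 <= 1 + r i * (a i u * b i v)) ->
  (forall i, mean gamma (a i) = 0) -> (forall i, mean gamma (b i) = 0) ->
  increasing_pred P -> increasing_pred Q -> (forall i, i \in l) ->
  gains l (fun x => (P x)%:R) (fun x => (Q x)%:R) <=
  E (fun x => (P x)%:R * (Q x)%:R) - E (fun x => (P x)%:R) * E (fun x => (Q x)%:R).
Proof.
move=> pos a0 b0 mP mQ lT.
rewrite -[leLHS](addKr (E (fun x => (P x)%:R) * E (fun x => (Q x)%:R))).
rewrite -coupled_gains addrC lerD2r; apply: (coupled_le_diagonal gamma_pmf) => //.
- by move=> i u v; rewrite mulr_ge0 // mulr_ge0 ?gamma_pmf.1.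
- move=> i u; have -> : gamma u = gamma u * (1 + r i * a i u * mean gamma (b i)).
    by rewrite b0 mulr0 addr0 mulr1.
  have <- : mean gamma (fun v => 1 + r i * a i u * b i v) = 1 + r i * a i u * mean gamma (b i).
    by rewrite (meanD (fun=> 1)) meanZ (mean_cst gamma_pmf).
  by rewrite /Defs.expectation_pmf mulr_sumr; apply: eq_bigr => v _; rewrite /K /tilted; ring.
- move=> i v; have -> : gamma v = gamma v * (1 + r i * b i v * mean gamma (a i)).
    by rewrite a0 mulr0 addr0 mulr1.
  have <- : mean gamma (fun u => 1 + r i * b i v * a i u) = 1 + r i * b i v * mean gamma (a i).
    by rewrite (meanD (fun=> 1)) meanZ (mean_cst gamma_pmf).
  by rewrite /Defs.expectation_pmf mulr_sumr; apply: eq_bigr => u _; rewrite /K /tilted; ring.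
Qed.

(** The lower bound of [mean_powR_moment] for the norm of [f] with exponent
    1/(1 + e). *)
Definition moment_bound (e : R) f : R := E f / 8 * (E f ^+ 2 / E (fun x => f x ^+ 2)) `^ e.

Lemma coupled_ge_moments l e d f g :
  (forall i u v, 0 <= 1 + r i * (a i u * b i v)) -> 0 < e <= 1 -> 0 < d <= 1 ->
  (forall j, j \in l -> reverse_hypercontractive gamma (K j) (1 + e) (1 + d)) ->
  (forall x, 0 <= f x) -> (forall x, 0 <= g x) ->
  moment_bound e f * moment_bound d g <= coupled gamma K l (tensor f g).
Proof.
move=> pos e01 d01 rh f0 g0; have /andP[e0 e1] := e01; have /andP[d0 d1] := d01.
have mb0 c h : (forall x, 0 <= h x) -> 0 <= moment_bound c h.
  by move=> h0; rewrite mulr_ge0 ?powR_ge0 // divr_ge0 // (mean_ge0 pmfE).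
apply: le_trans (ler_pM (mb0 _ _ f0) (mb0 _ _ g0) (mean_powR_moment pmfE e01 f0)
   (mean_powR_moment pmfE d01 g0)) _.
rewrite [leRHS](@eq_coupled _ _ _ gamma K l _ (tensor
   (fun x => (f x `^ (1 + e)^-1) `^ (1 + e)) (fun x => (g x `^ (1 + d)^-1) `^ (1 + d)))).
  apply: (coupled_reverse_hypercontractive gamma_pmf) => //.
  - by move=> h; apply: mean_powR_Jensen.
  - by move=> h; apply: mean_powR_Jensen.
  - by move=> i u v; rewrite mulr_ge0 // mulr_ge0 ?gamma_pmf.1.
  - by move=> x; rewrite powR_ge0.
  - by move=> x; rewrite powR_ge0.
move=> x y; rewrite /tensor -!powRrM !mulVf ?gt_eqF ?addr_gt0 //.
by rewrite !powRr1.
Qed.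

End Gains.
End Decomposition.

Section GainBounds.
Context {R : realType} {q n : nat} {gamma : 'I_q -> R}.
Context (gamma_pmf : is_pmf gamma).
Local Notation X := {ffun 'I_n -> 'I_q}.
Local Notation E := (mean (pmf_power gamma)).
Local Notation avg := (coord_op gamma).
Local Notation slope := (slope_op gamma).
Implicit Types (f g : X -> R) (i j : 'I_n) (l : seq 'I_n).

Let pmfE : is_pmf (@pmf_power R q n gamma) := pmf_power_is_pmf gamma_pmf.

Context (r : 'I_n -> R) (a b : 'I_n -> 'I_q -> R).
Let K j := tilted gamma (r j) (a j) (b j).
Context (a0 : forall i, mean gamma (a i) = 0) (b0 : forall i, mean gamma (b i) = 0).
Context (am : forall i (u v : 'I_q), (u <= v)%N -> a i u <= a i v).
Context (bm : forall i (u v : 'I_q), (u <= v)%N -> b i u <= b i v).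

(** Averaging does not change the mean slopes, so each summand of [gains] can be
    estimated from the mean of the slope of the initial functions. Ordering the
    coordinates by decreasing correlation makes the coordinates still coupled
    in the i-th summand at most as correlated as the i-th one. *)
Lemma gains_ge_sum (v : R) (D x y : 'I_n -> R) l f g : 0 <= v ->
  (forall i, mean gamma (fun u => a i u ^+ 2) <= v) ->
  (forall i, mean gamma (fun u => b i u ^+ 2) <= v) ->
  (forall i l' F G, (forall j, j \in l' -> r j <= r i) ->
    (forall z, 0 <= F z) -> (forall z, 0 <= G z) -> E F = x i -> E G = y i ->
    E (fun z => F z ^+ 2) <= v -> E (fun z => G z ^+ 2) <= v ->
    D i <= r i * coupled gamma K l' (tensor F G)) ->
  uniq l -> pairwise (fun i j => r j <= r i) l ->
  coord_increasing f -> coord_increasing g ->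
  E (fun z => f z ^+ 2) <= 1 -> E (fun z => g z ^+ 2) <= 1 ->
  (forall i, i \in l -> E (slope (a i) i f) = x i) ->
  (forall i, i \in l -> E (slope (b i) i g) = y i) ->
  \sum_(i <- l) D i <= gains (gamma := gamma) r a b l f g.
Proof.
move=> v0 av bv step; elim: l f g => [|i l IH] f g; first by rewrite big_nil.
move=> /= /andP[il ul] /andP[/allP ril pl] mf mg f1 g1 xf yg.
have small (c : 'I_q -> R) h : mean gamma c = 0 -> mean gamma (fun u => c u ^+ 2) <= v ->
    E (fun z => h z ^+ 2) <= 1 -> E (fun z => slope c i h z ^+ 2) <= v.
  move=> c0 cv h1; apply: le_trans (slope_sqr_le gamma_pmf i h c0 cv) _.
  rewrite -[leRHS]mulr1 ler_wpM2l //; apply: le_trans h1.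
  by rewrite gerBl; apply: (mean_ge0 pmfE) => z; rewrite sqr_ge0.
rewrite big_cons; apply: lerD.
  apply: step => //; rewrite ?small ?xf ?yg ?mem_head //.
  - by move=> z; apply: (slope_ge0 gamma_pmf) => //; apply: am.
  - by move=> z; apply: (slope_ge0 gamma_pmf) => //; apply: bm.
have ne j : j \in l -> j != i by move=> jl; apply: contraNneq il => <-.
apply: IH => //; try exact: increasing_avg.
- exact: le_trans (mean_avg_sqr_le gamma_pmf _ _) f1.
- exact: le_trans (mean_avg_sqr_le gamma_pmf _ _) g1.
- by move=> j jl; rewrite mean_slope_avg ?ne // xf // in_cons jl orbT.
- by move=> j jl; rewrite mean_slope_avg ?ne // yg // in_cons jl orbT.
Qed.

(** When E f E g is small the left-hand side is negative; otherwise the product of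
    the two ratios E[f]^2 / E[f^2] and E[g]^2 / E[g^2] is at least t^2. *)
Lemma moment_bound_mul (e t : R) f g : 0 <= e -> 0 <= t ->
  (forall z, 0 <= f z) -> (forall z, 0 <= g z) ->
  (t ^+ 2) `^ e / 64 * (E f * E g - t / 2 * (E (fun z => f z ^+ 2) + E (fun z => g z ^+ 2)))
  <= moment_bound (gamma := gamma) e f * moment_bound (gamma := gamma) e g.
Proof.
move=> e0 t0 f0 g0; rewrite /moment_bound.
set V := E (fun z => f z ^+ 2); set W := E (fun z => g z ^+ 2).
have x0 : 0 <= E f by apply: (mean_ge0 pmfE).
have y0 : 0 <= E g by apply: (mean_ge0 pmfE).
have xV : E f ^+ 2 <= V by apply: (mean_sqr_le pmfE).
have yW : E g ^+ 2 <= W by apply: (mean_sqr_le pmfE).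
have p0 : 0 <= (t ^+ 2) `^ e / 64 by rewrite divr_ge0 ?powR_ge0.
have [le0|gt0] := leP (E f * E g) (t / 2 * (V + W)).
  apply: (@le_trans _ _ 0); first by rewrite mulr_ge0_le0 // subr_le0.
  by rewrite !mulr_ge0 ?powR_ge0 ?divr_ge0.
set x := E f in x0 xV gt0 *; set y := E g in y0 yW gt0 *.
have V0 : 0 <= V by apply: le_trans xV; rewrite sqr_ge0.
have W0 : 0 <= W by apply: le_trans yW; rewrite sqr_ge0.
have xy0 : 0 < x * y by apply: le_lt_trans gt0; rewrite !mulr_ge0 ?addr_ge0 ?invr_ge0.
have xp : 0 < x by rewrite lt_neqAle x0 andbT; apply: contraTneq xy0 => <-; rewrite mul0r ltxx.
have yp : 0 < y by rewrite lt_neqAle y0 andbT; apply: contraTneq xy0 => <-; rewrite mulr0 ltxx.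
have Vp : 0 < V by apply: lt_le_trans xV; rewrite exprn_gt0.
have Wp : 0 < W by apply: lt_le_trans yW; rewrite exprn_gt0.
have tVW : t ^+ 2 <= (x ^+ 2 / V) * (y ^+ 2 / W).
  rewrite mulrACA -invfM ler_pdivlMr ?mulr_gt0 // -exprMn.
  apply: (@le_trans _ _ ((t / 2 * (V + W)) ^+ 2)).
    have -> : (t / 2 * (V + W)) ^+ 2 = t ^+ 2 * ((V + W) ^+ 2 / 4) by field.
    rewrite ler_wpM2l ?sqr_ge0 // ler_pdivlMr //; have := sqr_ge0 (V - W); nra.
  by rewrite ler_pXn2r ?nnegrE ?(ltW gt0) ?(ltW xy0) // !mulr_ge0 ?addr_ge0 ?invr_ge0.
apply: (@le_trans _ _ ((t ^+ 2) `^ e / 64 * (x * y))).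
  by rewrite ler_wpM2l // gerBl !mulr_ge0 ?addr_ge0 ?invr_ge0.
have -> : x / 8 * (x ^+ 2 / V) `^ e * (y / 8 * (y ^+ 2 / W) `^ e) =
  ((x ^+ 2 / V) `^ e * (y ^+ 2 / W) `^ e) / 64 * (x * y) by field.
rewrite ler_wpM2r ?(ltW xy0) // ler_wpM2r ?invr_ge0 //.
rewrite -powRM ?divr_ge0 ?sqr_ge0 // ge0_ler_powR ?nnegrE ?sqr_ge0 //.
by rewrite mulr_ge0 ?divr_ge0 ?sqr_ge0.
Qed.

(** With a common correlation the losses in [moment_bound_mul] add up to the
    energies, which Bessel's inequality controls. *)
Lemma gains_ge_energy (rho e t : R) l f g : 0 <= rho -> 0 < e <= 1 -> 0 <= t ->
  (forall i u v, 0 <= 1 + r i * (a i u * b i v)) -> (forall i, r i = rho) ->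
  (forall i, reverse_hypercontractive gamma (K i) (1 + e) (1 + e)) ->
  uniq l -> coord_increasing f -> coord_increasing g ->
  rho * ((t ^+ 2) `^ e / 64) *
    (\sum_(i <- l) E (slope (a i) i f) * E (slope (b i) i g) -
     t / 2 * (energy (gamma := gamma) a l f + energy (gamma := gamma) b l g))
  <= gains (gamma := gamma) r a b l f g.
Proof.
move=> rho0 e01 t0 pos rE rh; have /andP[e0 e1] := e01.
elim: l f g => [|i l IH] f g; first by rewrite big_nil /= addr0 mulr0 subrr mulr0.
move=> /= /andP[il ul] mf mg; rewrite big_cons.
have ne j : j \in l -> j != i by move=> jl; apply: contraNneq il => <-.
have := IH _ _ ul (increasing_avg gamma_pmf i mf) (increasing_avg gamma_pmf i mg).
rewrite [X in X - _](eq_big_seq (fun j => E (slope (a j) j f) * E (slope (b j) j g))); last first.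
  by move=> j jl; rewrite !mean_slope_avg ?ne.
have F0 z : 0 <= slope (a i) i f z by apply: (slope_ge0 gamma_pmf) => //; apply: am.
have G0 z : 0 <= slope (b i) i g z by apply: (slope_ge0 gamma_pmf) => //; apply: bm.
have h1 := moment_bound_mul (ltW e0) t0 F0 G0.
have h2 := coupled_ge_moments gamma_pmf (l := l) pos e01 e01 (fun j _ => rh j) F0 G0.
have := ler_wpM2l rho0 (le_trans h1 h2); rewrite -{2}(rE i) => h3 h4; apply: le_trans (lerD h3 h4).
by rewrite le_eqVlt; apply/orP; left; apply/eqP; ring.
Qed.

End GainBounds.

(** * The Gaussian isoperimetric profile *)

Section GaussianCdf.
Import numFieldNormedType.Exports.
Local Open Scope classical_set_scope.
Context {R : realType}.
Implicit Types u v w x : R.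

Local Notation phi := (@gauss_pdf R).
Local Notation Phi := (@gauss_cdf R).

Lemma gauss_pdfE x : phi x = normal_peak 1 * expR (- (x ^+ 2 / 2)).
Proof.
rewrite /gauss_pdf normal_pdfE ?oner_eq0 // /normal_fun subr0 expr1n.
by rewrite mulNr.
Qed.

Lemma gauss_pdf_gt0 x : 0 < phi x.
Proof. by rewrite gauss_pdfE mulr_gt0 ?expR_gt0 // normal_peak_gt0 ?oner_eq0. Qed.

Lemma gauss_pdf_le_half x : phi x <= 2^-1.
Proof.
apply: le_trans (normal_pdf_ub _ _ _) _; first by rewrite oner_eq0.
have pi4 : 4 <= pi * 2 :> R by have := @pi_ge2 R; lra.
rewrite /normal_peak expr1n mul1r -mulr_natr lef_pV2 ?posrE ?sqrtr_gt0; [|lra|lra].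
rewrite [leLHS](_ : _ = Num.sqrt 4); last by rewrite (_ : 4 = 2 ^+ 2) ?sqrtr_sqr ?ger0_norm //; ring.
by rewrite ler_sqrt; lra.
Qed.

Lemma is_derive_gauss_pdf x : is_derive x 1 phi (- x * phi x).
Proof.
rewrite (_ : phi = (fun y => normal_peak 1 * expR (- (y ^+ 2 / 2)))); last first.
  by apply/funext => y; rewrite gauss_pdfE.
by apply: is_derive_eq; rewrite /GRing.scale /=; field.
Qed.

Lemma is_derive_gauss_cdf x : is_derive x 1 Phi (phi x).
Proof.
have [] := @continuous_FTC1 R (normal_pdf 0 1) (BInfty R true) x (x + 1).
- by rewrite ltrDl.
- by apply: (integrableS _ _ (@subsetT _ _)) => //; exact: integrable_normal_pdf.
- by rewrite ltNyr.
- by apply: continuous_normal_pdf; rewrite oner_eq0.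
rewrite -[fun _ => _]/Phi derive1E => d dE; rewrite -[phi x]/(normal_pdf 0 1 x) -dE.
exact/derivableP.
Qed.

Let idT : measurableTypeR R -> R := idfun.

#[local] HB.instance Definition _ :=
  @isMeasurableFun.Build _ _ _ _ idT (@measurable_id _ _ setT).

Lemma gauss_cdf_cvgy : Phi x @[x --> +oo] --> (1 : R).
Proof.
have /fine_cvgP[_] := cvg_cdfy1 (idT : {RV (normal_prob 0 1 : probability _ R) >-> R}).
by rewrite (_ : fine \o _ = Phi).
Qed.

Lemma gauss_cdf_cvgNy : Phi x @[x --> -oo] --> (0 : R).
Proof.
have /fine_cvgP[_] := cvg_cdfNy0 (idT : {RV (normal_prob 0 1 : probability _ R) >-> R}).
by rewrite (_ : fine \o _ = Phi).
Qed.

Lemma gauss_pdfN x : phi (- x) = phi x.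
Proof. by rewrite !gauss_pdfE sqrrN. Qed.

Lemma gauss_pdf_cvgy : phi x @[x --> +oo] --> (0 : R).
Proof.
rewrite (_ : phi = (fun y => normal_peak 1 * expR (- (y ^+ 2 / 2)))); last first.
  by apply/funext => y; rewrite gauss_pdfE.
rewrite -(mulr0 (normal_peak 1)); apply: cvgM; first exact: cvg_cst.
apply: (cvg_comp (fun x => x ^+ 2 / 2) (fun x => expR (- x))); last exact: cvgr_expR.
by apply: gt0_cvgMly; [rewrite invr_gt0|exact: cvgr_expr2].
Qed.

Lemma gauss_pdf_cvgNy : phi x @[x --> -oo] --> (0 : R).
Proof.
apply/cvgNy_compNP; rewrite (_ : _ \o _ = phi); first exact: gauss_pdf_cvgy.
by apply/funext => x; rewrite /= gauss_pdfN.
Qed.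
End GaussianCdf.

Section GaussianProfile.
Import numFieldNormedType.Exports.
Local Open Scope classical_set_scope.
Context {R : realType}.
Implicit Types s t u v w x : R.

Local Notation phi := (@gauss_pdf R).
Local Notation Phi := (@gauss_cdf R).

Lemma is_derive_ndecr (f df : R -> R) (a b : R) :
  (forall x, is_derive x 1 f (df x)) -> a <= b ->
  (forall x, a <= x <= b -> 0 <= df x) -> f a <= f b.
Proof.
move=> fdf ab df0; apply: (@ger0_derive1_ndecr R f a b) => //.
- by move=> x; rewrite in_itv /= => /andP[ax xb]; rewrite derive1E derive_val df0 // !ltW.
- by apply: derivable_within_continuous => x _.
Qed.

Lemma gauss_cdf_ndecr u v : u <= v -> Phi u <= Phi v.
Proof.
move=> uv; apply: (is_derive_ndecr (df := phi)) => // [x|x _]; first exact: is_derive_gauss_cdf.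
by rewrite ltW // gauss_pdf_gt0.
Qed.

Lemma gauss_cdf_onto t : 0 < t < 1 -> exists u, Phi u = t.
Proof.
move=> /andP[t0 t1].
have [a at_] : exists a, Phi a <= t.
  have /cvgr_le/(_ t t0) := @gauss_cdf_cvgNy R.
  by move=> [M [_ h]]; exists (M - 1); apply: h; rewrite ltrBlDr ltrDl.
have [b tb] : exists b, t <= Phi b.
  have /cvgr_ge/(_ t t1) := @gauss_cdf_cvgy R.
  by move=> [M [_ h]]; exists (M + 1); apply: h; rewrite ltrDl.
have [ab|/ltW ba] := leP a b; last first.
  by exists a; apply/eqP; rewrite eq_le at_ (le_trans tb) // gauss_cdf_ndecr.
have [||c _ <-] := @IVT R Phi a b t ab; last by exists c.
  by apply: derivable_within_continuous => x _; have [] := is_derive_gauss_cdf x.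
by rewrite ge_min le_max at_ tb orbT.
Qed.

Lemma gauss_quantileK t : 0 < t < 1 -> Phi (gauss_quantile t) = t.
Proof.
move=> t01; rewrite /gauss_quantile pinvK // inE.
by have [u <-] := gauss_cdf_onto t01; exists u.
Qed.

Lemma gauss_quantile_lt s t : 0 < s < 1 -> 0 < t < 1 -> s < t ->
  gauss_quantile s <= gauss_quantile t.
Proof.
move=> s01 t01 st; rewrite leNgt; apply/negP => /ltW /gauss_cdf_ndecr.
by rewrite !gauss_quantileK // leNgt st.
Qed.

(** The functions a Phi(u/2) + b Phi(u) + c phi(u), whose derivative is
    elementary and whose limits at infinity are known. *)
Definition gauss_comb (a b c u : R) : R := a * Phi (u / 2) + b * Phi u + c * phi u.

Definition gauss_comb_derive (a b c u : R) : R :=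
  a / 2 * phi (u / 2) + b * phi u - c * (u * phi u).

Lemma is_derive_gauss_comb a b c u :
  is_derive u 1 (gauss_comb a b c) (gauss_comb_derive a b c u).
Proof.
have h1 : is_derive (u / 2) 1 Phi (phi (u / 2)) by exact: is_derive_gauss_cdf.
have h2 : is_derive u 1 Phi (phi u) by exact: is_derive_gauss_cdf.
have h3 := is_derive_gauss_pdf u.
have h4 : is_derive u 1 (fun x : R => x / 2) 2^-1.
  by apply: is_derive_eq; rewrite /GRing.scale /=; field.
have h5 : is_derive u 1 (fun x => Phi (x / 2)) (phi (u / 2) * 2^-1).
  exact: (@is_derive1_comp _ Phi (fun x => x / 2)).
rewrite /gauss_comb /gauss_comb_derive.
by apply: is_derive_eq; rewrite /GRing.scale /=; field.
Qed.

Lemma gauss_comb_cvgNy a b c : gauss_comb a b c u @[u --> -oo] --> (0 : R).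
Proof.
have -> : 0 = a * 0 + b * 0 + c * 0 :> R by ring.
apply: cvgD; [apply: cvgD|]; apply: cvgM; try exact: cvg_cst.
- apply: (cvg_comp (fun x => x / 2) Phi); last exact: gauss_cdf_cvgNy.
  by apply: gt0_cvgMlNy; [rewrite invr_gt0|].
- exact: gauss_cdf_cvgNy.
- exact: gauss_pdf_cvgNy.
Qed.

Lemma gauss_comb_cvgy a b c : gauss_comb a b c u @[u --> +oo] --> (a + b : R).
Proof.
have -> : a + b = a * 1 + b * 1 + c * 0 :> R by ring.
apply: cvgD; [apply: cvgD|]; apply: cvgM; try exact: cvg_cst.
- apply: (cvg_comp (fun x => x / 2) Phi); last exact: gauss_cdf_cvgy.
  by apply: gt0_cvgMly; [rewrite invr_gt0|].
- exact: gauss_cdf_cvgy.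
- exact: gauss_pdf_cvgy.
Qed.

(** [gauss_half t] is the Gaussian measure of the half-line at half the quantile
    of [t]; its extension to 0 and 1 is by continuity, as for [gauss_h]. *)
Definition gauss_half (t : R) : R :=
  if (0 < t) && (t < 1) then Phi (gauss_quantile t / 2) else t.

(** [gauss_comb] as a function of the measure t of the half-line. *)
Definition profile_comb (a b c t : R) : R := a * gauss_half t + b * t + c * gauss_h t.

Lemma profile_combE a b c t : 0 < t < 1 ->
  profile_comb a b c t = gauss_comb a b c (gauss_quantile t).
Proof.
move=> t01; rewrite /profile_comb /gauss_half /gauss_h t01 /gauss_comb.
by rewrite gauss_quantileK.
Qed.

Lemma profile_comb0 a b c : profile_comb a b c 0 = 0.
Proof. by rewrite /profile_comb /gauss_half /gauss_h ltxx /= !mulr0 !addr0. Qed.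

Lemma profile_comb1 a b c : profile_comb a b c 1 = a + b.
Proof. by rewrite /profile_comb /gauss_half /gauss_h ltxx andbF !mulr1 mulr0 addr0. Qed.

Lemma profile_comb_left a b c s t : 0 < t < 1 -> 0 <= s <= t ->
  (forall u, u <= gauss_quantile t -> 0 <= gauss_comb_derive a b c u) ->
  profile_comb a b c s <= profile_comb a b c t.
Proof.
move=> t01 /andP[s0 st] d0; rewrite [leRHS]profile_combE //.
have incr u v : u <= v -> v <= gauss_quantile t -> gauss_comb a b c u <= gauss_comb a b c v.
  move=> uv vt; apply: (is_derive_ndecr (is_derive_gauss_comb a b c)) => // x /andP[_ xv].
  exact/d0/(le_trans xv).
move: s0; rewrite le_eqVlt => /predU1P[<-|s0].
  rewrite profile_comb0; apply: (cvgr_to_le (@gauss_comb_cvgNy a b c)).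
  near=> u; apply: incr => //; near: u; exact: nbhs_ninfty_le.
move: st; rewrite le_eqVlt => /predU1P[->|st]; first by rewrite profile_combE.
have s01 : 0 < s < 1 by rewrite s0 (lt_trans st) //; case/andP: t01.
by rewrite profile_combE // incr // gauss_quantile_lt.
Unshelve. all: by end_near. Qed.

Lemma profile_comb_right a b c t r : 0 < t < 1 -> t <= r <= 1 ->
  (forall u, gauss_quantile t <= u -> 0 <= gauss_comb_derive a b c u) ->
  profile_comb a b c t <= profile_comb a b c r.
Proof.
move=> t01 /andP[tr r1] d0; rewrite [leLHS]profile_combE //.
have incr u v : u <= v -> gauss_quantile t <= u -> gauss_comb a b c u <= gauss_comb a b c v.
  move=> uv tu; apply: (is_derive_ndecr (is_derive_gauss_comb a b c)) => // x /andP[ux _].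
  exact/d0/(le_trans tu).
move: r1; rewrite le_eqVlt => /predU1P[->|r1].
  rewrite profile_comb1; apply: (cvgr_to_ge (@gauss_comb_cvgy a b c)).
  near=> u; apply: incr => //; near: u; exact: nbhs_pinfty_ge.
move: tr; rewrite le_eqVlt => /predU1P[<-|tr]; first by rewrite profile_combE.
have r01 : 0 < r < 1 by rewrite r1 andbT (lt_trans _ tr) //; case/andP: t01.
by rewrite profile_combE // incr // gauss_quantile_lt.
Unshelve. all: by end_near. Qed.

Lemma profile_comb_ndecr a b c s t : 0 <= s -> s < t -> t <= 1 ->
  (forall u, 0 <= gauss_comb_derive a b c u) ->
  profile_comb a b c s <= profile_comb a b c t.
Proof.
move=> s0 st t1 d0.
pose m := (s + t) / 2.
have m01 : 0 < m < 1 by rewrite /m; lra.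
apply: (@le_trans _ _ (profile_comb a b c m)).
  by apply: profile_comb_left => //; rewrite /m; lra.
by apply: profile_comb_right => //; rewrite /m; lra.
Qed.

(** The mean of exp(3 x^2 / 8) over the part of the line of measure t - s between
    two quantiles is bounded below by Jensen's inequality; the mean of -x there is
    the slope of [gauss_h]. The tangent line to y |-> exp(3y/8) at y = k^2 turns
    Jensen's inequality into the monotonicity of a [gauss_comb]. *)
Lemma gauss_h_slope_exp s t k : 0 <= s -> s < t -> t <= 1 ->
  gauss_h t - gauss_h s = k * (t - s) ->
  (t - s) * expR (3 / 8 * k ^+ 2) <= 2 * (gauss_half t - gauss_half s).
Proof.
move=> s0 st t1 hk; set e := expR _.
have := @profile_comb_ndecr 2 (- (e * (1 - 3 / 4 * k ^+ 2))) (- (e * (3 / 4 * k))) s t s0 st t1.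
rewrite /profile_comb => h.
have {}h := h _; suff d0 u : 0 <= gauss_comb_derive 2 (- (e * (1 - 3 / 4 * k ^+ 2)))
    (- (e * (3 / 4 * k))) u.
  have {}h := h d0.
  have hE : gauss_h t = gauss_h s + k * (t - s) by rewrite -hk; ring.
  rewrite hE in h; move: h; set G1 := gauss_half t; set G0 := gauss_half s; nra.
rewrite /gauss_comb_derive divff ?pnatr_eq0 // mul1r.
have -> : phi (u / 2) = phi u * expR (3 / 8 * u ^+ 2).
  by rewrite !gauss_pdfE -[RHS]mulrA -expRD; congr (_ * expR _); field.
have -> : phi u * expR (3 / 8 * u ^+ 2) + - (e * (1 - 3 / 4 * k ^+ 2)) * phi u -
   - (e * (3 / 4 * k)) * (u * phi u) =
   phi u * (expR (3 / 8 * u ^+ 2) - e * (1 - 3 / 4 * k * (k + u))).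
  ring.
rewrite mulr_ge0 ?(ltW (gauss_pdf_gt0 u)) // subr_ge0.
have -> : 3 / 8 * u ^+ 2 = 3 / 8 * k ^+ 2 + (3 / 8 * u ^+ 2 - 3 / 8 * k ^+ 2) by ring.
rewrite expRD -/e ler_wpM2l ?expR_ge0 //; apply: le_trans (expR_ge1Dx _).
have := sqr_ge0 (u + k); nra.
Qed.

(** Concavity of [gauss_h]: x |-> phi(x) + w Phi(x) is largest at x = w. *)
Lemma gauss_h_chord s t r : 0 <= s -> s < t -> t < r -> r <= 1 ->
  (gauss_h r - gauss_h t) * (t - s) <= (gauss_h t - gauss_h s) * (r - t).
Proof.
move=> s0 st tr r1; pose w := gauss_quantile t.
have t01 : 0 < t < 1 by rewrite (le_lt_trans s0 st) (lt_le_trans tr r1).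
have hl : profile_comb 0 w 1 s <= profile_comb 0 w 1 t.
  apply: profile_comb_left => // [|u uw]; first by rewrite s0 ltW.
  rewrite /gauss_comb_derive (_ : _ - _ = (w - u) * phi u); last by ring.
  by rewrite mulr_ge0 ?subr_ge0 // ltW // gauss_pdf_gt0.
have hr : profile_comb 0 (- w) (- 1) t <= profile_comb 0 (- w) (- 1) r.
  apply: profile_comb_right => // [|u uw]; first by rewrite r1 ltW.
  rewrite /gauss_comb_derive (_ : _ - _ = (u - w) * phi u); last by ring.
  by rewrite mulr_ge0 ?subr_ge0 // ltW // gauss_pdf_gt0.
move: hl hr; rewrite /profile_comb !mul0r !add0r !mul1r !mulN1r => hl hr.
have h1 : - w * (t - s) <= gauss_h t - gauss_h s by lra.
have h2 : gauss_h r - gauss_h t <= - w * (r - t) by lra.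
have ts : 0 <= t - s by rewrite subr_ge0 ltW.
have rt : 0 <= r - t by rewrite subr_ge0 ltW.
have := ler_wpM2r rt h1; have := ler_wpM2r ts h2; nra.
Qed.

Lemma gauss_h_ge0 t : 0 <= gauss_h t.
Proof. by rewrite /gauss_h; case: ifP => // _; rewrite ltW // gauss_pdf_gt0. Qed.

Lemma gauss_h_le_half t : gauss_h t <= 2^-1.
Proof.
by rewrite /gauss_h; case: ifP => // _; exact: gauss_pdf_le_half.
Qed.

End GaussianProfile.

(** * The Gaussian score of an ordered probability space *)

Section Score.
Context {R : realType} {q : nat} {gamma : 'I_q -> R}.
Context (gamma_pmf : is_pmf gamma) (gamma_gt0 : forall u, 0 < gamma u).
Implicit Types (k : nat) (u v : 'I_q).

Definition tail k : R := \sum_(u < q | (k <= u)%N) gamma u.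

Lemma tailS u : tail u = gamma u + tail u.+1.
Proof.
rewrite /tail (bigD1 u) //=; congr (_ + _); apply: eq_bigl => v.
by rewrite andbC ltn_neqAle eq_sym.
Qed.

Lemma tail0 : tail 0 = 1. Proof. exact: gamma_pmf.2. Qed.

Lemma tailq : tail q = 0.
Proof. by apply: big_pred0 => u; rewrite leqNgt ltn_ord. Qed.

Lemma tail_ge0 k : 0 <= tail k.
Proof. by apply: sumr_ge0 => u _; rewrite ltW. Qed.

Lemma tail_le1 k : tail k <= 1.
Proof.
rewrite -tail0 /tail [leRHS](bigID (fun u : 'I_q => (k <= u)%N)) /= lerDl.
by apply: sumr_ge0 => u _; rewrite ltW.
Qed.

(** If the points of 'I_q are laid out on the Gaussian line from right to left,
    as consecutive intervals of measures [gamma u], this is minus the barycentre of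
    the interval of [u]; so [x |-> - x] is replaced by its conditional mean. *)
Definition score u : R := (gauss_h (tail u) - gauss_h (tail u.+1)) / gamma u.

Lemma mul_score u : gamma u * score u = gauss_h (tail u) - gauss_h (tail u.+1).
Proof. by rewrite /score mulrCA divff ?mulr1 // gt_eqF. Qed.

Lemma sum_score_tail k : (k <= q)%N ->
  \sum_(u < q | (k <= u)%N) gamma u * score u = gauss_h (tail k).
Proof.
move=> kq; under eq_bigr do rewrite mul_score.
have -> : \sum_(u < q | (k <= u)%N) (gauss_h (tail u) - gauss_h (tail u.+1)) =
    \sum_(k <= i < q) (gauss_h (tail i) - gauss_h (tail i.+1)).
  by rewrite big_geq_mkord.
rewrite (eq_bigr (fun i => - gauss_h (tail i.+1) - - gauss_h (tail i))) => [|i _]; last by ring.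
rewrite (telescope_sumr (fun i => - gauss_h (tail i))) // tailq.
by rewrite opprK {1}/gauss_h ltxx oppr0 add0r.
Qed.

(** An up-set of 'I_q is a final segment. *)
Lemma sum_score_upset (P : pred 'I_q) :
  (forall u v, (u <= v)%N -> P u -> P v) ->
  \sum_u gamma u * score u * (P u)%:R = gauss_h (\sum_(u | P u) gamma u).
Proof.
move=> mP.
have [k kq kP] : exists2 k, (k <= q)%N & forall u, P u = (k <= u)%N.
  have [/existsP[u0 Pu0]|/existsPn noP] := boolP [exists u, P u]; last first.
    by exists q => // u; rewrite leqNgt ltn_ord; apply/negbTE.
  exists [arg min_(u < u0 | P u) (u : nat)]%N; first exact: ltnW.
  case: arg_minnP => // w Pw minw u; apply/idP/idP => [/minw //|wu].
  exact: mP wu Pw.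
rewrite (eq_bigl _ _ kP) -/(tail k) -sum_score_tail // [RHS]big_mkcond /=.
by apply: eq_bigr => u _; rewrite kP; case: leqP; rewrite ?mulr1 ?mulr0.
Qed.

Lemma mean_score : mean gamma score = 0.
Proof.
rewrite /Defs.expectation_pmf (eq_bigl (fun u : 'I_q => (0 <= u)%N)) //.
by rewrite sum_score_tail // tail0 /gauss_h ltxx andbF.
Qed.

Lemma score_ndecr u v : (u <= v)%N -> score u <= score v.
Proof.
have step u' v' : v' = u'.+1 :> nat -> score u' <= score v'.
  move=> e; rewrite /score ler_pdivrMr // mulrAC ler_pdivlMr //.
  have gu : gamma u' = tail u' - tail v' by rewrite e tailS addrK.
  have gv : gamma v' = tail v' - tail v'.+1 by rewrite tailS addrK.
  rewrite -e {1}gv [in leRHS]gu; apply: gauss_h_chord.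
  - exact: tail_ge0.
  - by rewrite -subr_gt0 -gv.
  - by rewrite -subr_gt0 -gu.
  - exact: tail_le1.
have aux d u' v' : v' = (u' + d)%N :> nat -> score u' <= score v'.
  elim: d v' => [|d IH] v' e.
    by rewrite (_ : v' = u') //; apply: val_inj; rewrite /= e addn0.
  have lt : (u' + d < q)%N by rewrite (leq_trans _ (ltn_ord v')) // e addnS.
  apply: le_trans (IH (Ordinal lt) erefl) _; apply: step.
  by rewrite e addnS.
by move=> uv; apply: (aux (v - u)%N); rewrite subnKC.
Qed.

Lemma mean_exp_score : mean gamma (fun u => expR (3 / 8 * score u ^+ 2)) <= 2.
Proof.
apply: (@le_trans _ _ (\sum_(u < q) 2 * (gauss_half (tail u) - gauss_half (tail u.+1)))).
  apply: ler_sum => u _; have gu : gamma u = tail u - tail u.+1 by rewrite tailS addrK.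
  rewrite {1}gu; apply: gauss_h_slope_exp; rewrite ?tail_ge0 ?tail_le1 //.
    by rewrite -subr_gt0 -gu.
  by rewrite -gu mulrC mul_score.
rewrite -mulr_sumr -(big_mkord xpredT (fun i => gauss_half (tail i) - gauss_half (tail i.+1))).
rewrite (eq_bigr (fun i => - gauss_half (tail i.+1) - - gauss_half (tail i))) => [|i _]; last by ring.
rewrite (telescope_sumr (fun i => - gauss_half (tail i))) // tailq tail0.
by rewrite /gauss_half !ltxx andbF /=; lra.
Qed.

Local Notation E := (mean gamma).

Lemma mean_score_sqr : E (fun u => score u ^+ 2) <= 4.
Proof.
have h : E (fun u => 1 + 3 / 8 * score u ^+ 2 + 0 * score u) <= 2.
  apply: le_trans mean_exp_score; apply: (mean_le gamma_pmf) => u.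
  by rewrite mul0r addr0; exact: expR_ge1Dx.
rewrite (mean_affine gamma_pmf) in h; lra.
Qed.

(** * Truncated scores *)

Definition clip (M x : R) : R := Num.max (- M) (Num.min M x).

Lemma clip_ndecr M x y : x <= y -> clip M x <= clip M y.
Proof.
move=> xy; rewrite /clip ge_max le_max lexx /= le_max; apply/orP; right.
by rewrite le_min !ge_min lexx xy orbT.
Qed.

Lemma clip_norm M x : 0 <= M -> `|clip M x| <= M.
Proof.
move=> M0; rewrite ler_norml /clip le_max lexx /= ge_max ge_min lexx /= andbT.
by rewrite (le_trans _ M0) // oppr_le0.
Qed.

Lemma clip_sqr M x : 0 <= M -> clip M x ^+ 2 <= x ^+ 2.
Proof.
move=> M0; rewrite /clip /Num.max /Num.min; case: (ltP M x) => h; case: ifP => h2; nra.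
Qed.

Lemma clip_err M x : 0 <= M -> (x - clip M x) ^+ 2 <= 8 * expR (- (M ^+ 2 / 8)) * expR (x ^+ 2 / 4).
Proof.
move=> M0; have [xM|Mx] := leP `|x| M.
  have -> : clip M x = x.
    move: xM; rewrite ler_norml => /andP[h1 h2].
    by rewrite /clip; rewrite (min_idPr _) // (max_idPr _).
  by rewrite subrr expr0n /= mulr_ge0 ?mulr_ge0 ?expR_ge0.
have x2 : M ^+ 2 <= x ^+ 2.
  by rewrite -[x ^+ 2]real_normK ?num_real // ler_pXn2r ?nnegrE // ltW.
apply: (@le_trans _ _ (x ^+ 2)).
  rewrite /clip /Num.max /Num.min; case: (ltP M x) => h; case: ifP => h2; nra.
have e1 := expR_ge1Dx (x ^+ 2 / 8).
have -> : 8 * expR (- (M ^+ 2 / 8)) * expR (x ^+ 2 / 4) =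
  8 * expR (x ^+ 2 / 8) * expR (x ^+ 2 / 8 - M ^+ 2 / 8).
  by rewrite -!mulrA -!expRD; congr (_ * expR _); field.
have e2 : 1 <= expR (x ^+ 2 / 8 - M ^+ 2 / 8) by rewrite -[leLHS]expR0 ler_expR; lra.
apply: (@le_trans _ _ (8 * expR (x ^+ 2 / 8))); first by have := sqr_ge0 x; lra.
by rewrite ler_peMr // mulr_ge0 ?expR_ge0.
Qed.

(** The truncation level 4 sqrt(L + 5) makes the mean square error of the
    truncation at most 16 exp(- 2 (L + 5)). *)
Definition clip_level (L : R) : R := 4 * Num.sqrt (L + 5).

Definition clipped_score (L : R) u : R :=
  clip (clip_level L) (score u) - E (fun v => clip (clip_level L) (score v)).

Section ClippedScore.
Context (L : R) (L0 : 0 <= L).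
Let M := clip_level L.

Let M0 : 0 <= M. Proof. by rewrite mulr_ge0 ?sqrtr_ge0. Qed.

Let Msqr : M ^+ 2 = 16 * (L + 5).
Proof. by rewrite /M /clip_level exprMn sqr_sqrtr ?addr_ge0 //; ring. Qed.

Lemma mean_clipped : E (clipped_score L) = 0.
Proof. by rewrite /clipped_score meanB (mean_cst gamma_pmf) subrr. Qed.

Lemma clipped_ndecr u v : (u <= v)%N -> clipped_score L u <= clipped_score L v.
Proof. by move=> uv; rewrite lerD2r clip_ndecr // score_ndecr. Qed.

Lemma clipped_norm u : `|clipped_score L u| <= 2 * M.
Proof.
apply: le_trans (ler_normB _ _) _; rewrite mulr_natl mulr2n lerD ?clip_norm //.
apply: le_trans (mean_norm gamma_pmf _) _.
rewrite -[leRHS](mean_cst gamma_pmf); apply: (mean_le gamma_pmf) => v.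
exact: clip_norm.
Qed.

Let mc := E (fun v => clip M (score v)).

Let variance_le (f : 'I_q -> R) : E (fun u => (f u - E f) ^+ 2) <= E (fun u => f u ^+ 2).
Proof.
rewrite (@eq_mean _ _ _ _ (fun u => f u ^+ 2 - (2 * E f * f u - E f ^+ 2 * 1))) => [|u].
  rewrite meanB (meanB (fun u => 2 * E f * f u)) !meanZ (mean_cst gamma_pmf).
  have := sqr_ge0 (E f); lra.
by ring.
Qed.

Lemma mean_clipped_sqr : E (fun u => clipped_score L u ^+ 2) <= 4.
Proof.
apply: le_trans (variance_le _) _; apply: le_trans mean_score_sqr.
by apply: (mean_le gamma_pmf) => u; apply: clip_sqr.
Qed.

Lemma mean_exp_clipped : E (fun u => expR (clipped_score L u ^+ 2 / 8)) <= 2 * expR 1.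
Proof.
have mc4 : mc ^+ 2 <= 4.
  apply: le_trans (mean_sqr_le gamma_pmf _) _; apply: le_trans mean_score_sqr.
  by apply: (mean_le gamma_pmf) => u; apply: clip_sqr.
apply: (@le_trans _ _ (E (fun u => expR 1 * expR (3 / 8 * score u ^+ 2)))).
  apply: (mean_le gamma_pmf) => u; rewrite -expRD ler_expR.
  have c2 := clip_sqr (score u) M0; have s2 := sqr_ge0 (score u).
  rewrite /clipped_score -/M -/mc.
  have := sqr_ge0 (clip M (score u) + mc); nra.
by rewrite meanZ mulrC ler_wpM2r ?expR_ge0 // mean_exp_score.
Qed.

Lemma mean_clipped_err :
  E (fun u => (score u - clipped_score L u) ^+ 2) <= 16 * expR (- (2 * (L + 5))).
Proof.
pose f u := score u - clip M (score u).
have Ef : E f = - mc by rewrite /f meanB mean_score sub0r.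
rewrite (@eq_mean _ _ _ _ (fun u => (f u - E f) ^+ 2)) => [|u]; last first.
  by rewrite Ef /f /clipped_score -/M -/mc; ring.
apply: le_trans (variance_le _) _.
apply: (@le_trans _ _ (E (fun u => 8 * expR (- (M ^+ 2 / 8)) * expR (3 / 8 * score u ^+ 2)))).
  apply: (mean_le gamma_pmf) => u; apply: le_trans (clip_err _ M0) _.
  rewrite ler_wpM2l ?mulr_ge0 ?expR_ge0 // ler_expR; have := sqr_ge0 (score u); lra.
rewrite meanZ Msqr (_ : 16 * (L + 5) / 8 = 2 * (L + 5)); last by field.
have := ler_wpM2l (expR_ge0 (- (2 * (L + 5)))) mean_exp_score; lra.
Qed.

Lemma subgaussian_clipped : subgaussian (gamma := gamma) (2 * expR 1) (2 * M) (clipped_score L).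
Proof.
split; [exact: mean_clipped|exact: clipped_norm|exact: mean_exp_clipped].
Qed.

End ClippedScore.
End Score.

(** * Admissible correlations *)

(** Truncated scores are bounded by 8 sqrt(l + 5), where l + 5 <= 11 l for l >= 1/2
    and l + 5 <= 6 l for l >= 1. Products of two bounds are thus at most
    704 sqrt(l l') and 384 l, whence the constants 1408 and 768 below. *)
Section Rates.
Context {R : realType}.
Implicit Types x l k s w z : R.

Lemma expR_log1V x : 0 < x -> expR (- ln (1 / x)) = x.
Proof. by move=> x0; rewrite div1r lnV ?posrE // opprK lnK. Qed.

Lemma log1V_ge_half x : 0 < x -> x <= 2^-1 -> 2^-1 <= ln (1 / x).
Proof.
move=> x0 x2; rewrite div1r lnV ?posrE // lerNr.
rewrite -ler_expR lnK ?posrE //; apply: (le_trans x2).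
by have := expR_ge1Dx (- 2^-1 : R); lra.
Qed.

Lemma log1V_ge0 x : 0 <= x -> x <= 2^-1 -> 0 <= ln (1 / x).
Proof.
rewrite le_eqVlt => /predU1P[<- _|x0 /(log1V_ge_half x0)]; last by lra.
by rewrite invr0 mulr0 ln0.
Qed.

Lemma inv_double_itv l : 2^-1 <= l -> 0 < (2 * l)^-1 <= 1.
Proof. by move=> hl; rewrite invr_gt0 invf_le1; lra. Qed.

Lemma clip_level_gt0 l : 0 <= l -> 0 < 2 * clip_level l.
Proof.
move=> l0; apply: mulr_gt0 => //; apply: mulr_gt0 => //.
by rewrite sqrtr_gt0; lra.
Qed.

Lemma clip_level_mul l l' : 2^-1 <= l -> 2^-1 <= l' ->
  clip_level l * clip_level l' <= 176 * Num.sqrt (l * l').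
Proof.
move=> h h'; have l0 : 0 <= l * l' by rewrite mulr_ge0; lra.
suff key : Num.sqrt (l + 5) * Num.sqrt (l' + 5) <= 11 * Num.sqrt (l * l').
  by rewrite /clip_level mulrACA; lra.
have s0 := sqrtr_ge0 (l * l').
have h11 : 0 <= 11 * Num.sqrt (l * l') by lra.
rewrite -(@ler_pXn2r _ 2) ?nnegrE ?mulr_ge0 ?sqrtr_ge0 //.
rewrite !exprMn !sqr_sqrtr; [|exact: l0|lra|lra].
apply: (@le_trans _ _ ((11 * l) * (11 * l'))); last by lra.
by apply: ler_pM; lra.
Qed.

Lemma tilt_rate k s z : 0 < k -> 0 < s -> z <= 176 * s ->
  2 * (k / (1408 * s)) * (4 * z) <= k.
Proof.
move=> k0 s0 zs; have -> : 2 * (k / (1408 * s)) * (4 * z) = k * (z / (176 * s)).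
  by field; rewrite gt_eqF.
have s1 : 0 < 176 * s by rewrite mulr_gt0 ?ltr0n.
rewrite -[leRHS]mulr1; apply: ler_wpM2l; first exact: ltW.
by rewrite ler_pdivrMr ?mul1r.
Qed.

Lemma tilt_rate_sqr k l l' : 0 <= k -> 2^-1 <= l -> 2^-1 <= l' ->
  (2 * (k / (1408 * Num.sqrt (l * l')))) ^+ 2 <= k ^+ 2 * ((2 * l)^-1 * (2 * l')^-1).
Proof.
move=> k0 h h'; have l0 : 0 < l by lra.
have l0' : 0 < l' by lra.
have s0 : 0 < Num.sqrt (l * l') by rewrite sqrtr_gt0 mulr_gt0.
have ks : 0 <= k / Num.sqrt (l * l') by rewrite divr_ge0 // ltW.
apply: (@le_trans _ _ ((k / Num.sqrt (l * l') / 2) ^+ 2)).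
  have -> : 2 * (k / (1408 * Num.sqrt (l * l'))) = k / Num.sqrt (l * l') / 704.
    by field; rewrite gt_eqF.
  by move: (k / _) ks => z z0; apply: lerXn2r; rewrite ?nnegrE; lra.
rewrite !exprMn !exprVn sqr_sqrtr; last by rewrite mulr_ge0 // ltW.
by rewrite le_eqVlt; apply/orP; left; apply/eqP; field; rewrite !gt_eqF.
Qed.

Lemma tilt_pos k z w : k <= 1 -> 2 * z <= k -> - w <= z -> 0 <= 1 + w.
Proof. lra. Qed.

Lemma expR10_ge : 64 <= expR 10 :> R.
Proof.
have h : 4 <= expR (10 / 3) :> R by have := expR_ge1Dx (10 / 3 : R); lra.
have -> : (10 : R) = 3%:R * (10 / 3) by field.
rewrite expRM_natl exprS expr2; move: (expR _) h => y h.
have h2 : 16 <= y * y by nra.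
have := ler_pM (ler0n R 4) (ler0n R 16) h h2; lra.
Qed.

End Rates.

(** * Influences as mean slopes *)

Section Correlation.
Context {R : realType} {q n : nat} {gamma : 'I_q -> R}.
Context (gamma_pmf : is_pmf gamma) (gamma_gt0 : forall u, 0 < gamma u).
Local Notation X := {ffun 'I_n -> 'I_q}.
Local Notation E := (mean (pmf_power gamma)).
Local Notation slope := (slope_op gamma).
Local Notation score := (score (gamma := gamma)).
Local Notation clipped := (clipped_score (gamma := gamma)).
Implicit Types (A B : {set X}) (i j : 'I_n) (L : R).

Let pmfE : is_pmf (@pmf_power R q n gamma) := pmf_power_is_pmf gamma_pmf.

Definition ind A (x : X) : R := (x \in A)%:R.

Lemma fin_measure_ind A : fin_measure (pmf_power gamma) A = E (ind A).
Proof.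
rewrite /fin_measure big_mkcond; apply: eq_bigr => x _; rewrite /ind.
by case: (x \in A); rewrite ?mulr1 ?mulr0.
Qed.

Lemma fin_measureI_ind A B :
  fin_measure (pmf_power gamma) (A :&: B) = E (fun x => ind A x * ind B x).
Proof. by rewrite fin_measure_ind; apply: eq_mean => x; rewrite /ind inE -natrM mulnb. Qed.

Lemma increasing_pred_mem A : increasing_set A -> increasing_pred (fun x => x \in A).
Proof. by move=> mA x i u v uv; have := mA x i u v uv; case: (_ \in A); case: (_ \in A). Qed.

Lemma increasing_ind A : increasing_set A -> coord_increasing (ind A).
Proof. by move=> mA x i u v uv; rewrite ler_nat mA. Qed.

Lemma mean_ind_sqr A : E (fun x => ind A x ^+ 2) = E (ind A).
Proof. by apply: eq_mean => x; rewrite /ind; case: (x \in A); rewrite ?expr1n ?expr0n. Qed.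

Lemma mean_ind_sqr_le1 A : E (fun x => ind A x ^+ 2) <= 1.
Proof.
rewrite mean_ind_sqr -[leRHS](mean_cst pmfE); apply: (mean_le pmfE) => x.
by rewrite /ind; case: (x \in A).
Qed.

Lemma variance_ind_le A : E (fun x => ind A x ^+ 2) - E (ind A) ^+ 2 <= 4^-1.
Proof. rewrite mean_ind_sqr; have := sqr_ge0 (2 * E (ind A) - 1); nra. Qed.

(** The fiber of an increasing set is a final segment, over which the scores
    integrate to the Gaussian boundary measure. *)
Lemma h_influence_score A i : increasing_set A ->
  h_influence gamma A i = E (slope score i (ind A)).
Proof.
move=> mA; apply: eq_mean => x; rewrite /slope_op /coord_op /ind.
rewrite (sum_score_upset gamma_gt0 (P := fun u => update x i u \in A)).
  by congr gauss_h; rewrite /fin_measure; apply: eq_bigl => u; rewrite inE.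
exact: increasing_pred_mem.
Qed.

Lemma h_influence_ge0 A i : 0 <= h_influence gamma A i.
Proof. by apply: (mean_ge0 pmfE) => x; apply: gauss_h_ge0. Qed.

Lemma h_influence_le_half A i : h_influence gamma A i <= 2^-1.
Proof.
rewrite -[leRHS](mean_cst pmfE); apply: (mean_le pmfE) => x.
exact: gauss_h_le_half.
Qed.

Lemma sum_h_influence_sqr A : increasing_set A ->
  \sum_(i < n) h_influence gamma A i ^+ 2 <= 1.
Proof.
move=> mA; under eq_bigr do rewrite h_influence_score //.
apply: le_trans (sum_mean_slope_sqr_le gamma_pmf (a := fun=> score) (v := 4) (ind A)
  (index_enum_uniq _) _ _ _) _ => // [i|i|].
- exact: mean_score.
- exact: mean_score_sqr.
have := variance_ind_le A; lra.
Qed.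

Lemma mean_slopeB (a b : 'I_q -> R) i f :
  E (slope (fun u => a u - b u) i f) = E (slope a i f) - E (slope b i f).
Proof.
rewrite -meanB; apply: eq_mean => x; rewrite /slope_op /coord_op -sumrB.
by apply: eq_bigr => u _; ring.
Qed.

Definition clipped_influence (L : R) A i : R := E (slope (clipped L) i (ind A)).

(** By Bessel's inequality, truncating the scores perturbs the whole vector of
    influences by little in the square norm. *)
Lemma clipped_influence_err L A (l : seq 'I_n) : 0 <= L -> increasing_set A -> uniq l ->
  \sum_(i <- l) (h_influence gamma A i - clipped_influence L A i) ^+ 2 <=
  16 * expR (- (2 * (L + 5))).
Proof.
move=> L0 mA ul; set v := _ * _.
have v0 : 0 <= v by rewrite mulr_ge0 ?expR_ge0.
under eq_bigr do rewrite h_influence_score // /clipped_influence -mean_slopeB.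
apply: le_trans (sum_mean_slope_sqr_le gamma_pmf (v := v)
  (a := fun=> (fun u => score u - clipped L u)) (ind A) ul v0 _ _) _.
- by move=> i; rewrite meanB mean_score // mean_clipped // subrr.
- by move=> i; apply: mean_clipped_err.
have := variance_ind_le A; have := v0; nra.
Qed.

Definition subgauss_const : R := 2 * expR 1.

Lemma subgauss_const_ge1 : 1 <= subgauss_const.
Proof. have := expR_ge1Dx (1 : R); rewrite /subgauss_const; lra. Qed.

(** With e = 1 / (2 l) and x = exp(- l), the power x^(2e) is exp(- 1). *)
Lemma moment_bound_ge (x l : R) (F : X -> R) : expR (- l) = x -> 2^-1 <= l ->
  (forall z, 0 <= F z) -> x / 2 <= E F -> E (fun z => F z ^+ 2) <= 4 ->
  x * (expR (-1) / 256) <= moment_bound (gamma := gamma) (2 * l)^-1 F.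
Proof.
move=> xl l2 F0 xF V4; rewrite /moment_bound; set e := (2 * l)^-1.
have x0 : 0 < x by rewrite -xl expR_gt0.
have xE : x ^+ 2 = expR (- (2 * l)) by rewrite -xl -expRM_natl mulrN.
move: V4; set V := E (fun z => F z ^+ 2) => V4.
have EF0 : 0 < E F by apply: lt_le_trans xF; rewrite divr_gt0.
have V0 : 0 < V by apply: lt_le_trans (mean_sqr_le pmfE F); rewrite exprn_gt0.
have /andP[e0 e1] : 0 < e <= 1 := inv_double_itv l2.
have h1 : x ^+ 2 * 16^-1 <= E F ^+ 2 / V.
  rewrite ler_pdivlMr //; apply: (@le_trans _ _ (x ^+ 2 * 16^-1 * 4)).
    by rewrite ler_wpM2l // mulr_ge0 ?sqr_ge0 // invr_ge0 ler0n.
  apply: (@le_trans _ _ ((x / 2) ^+ 2)); first by rewrite exprMn; lra.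
  by rewrite ler_pXn2r ?nnegrE ?(ltW EF0) // divr_ge0 // ltW.
have h2 : expR (-1) * 16^-1 <= (E F ^+ 2 / V) `^ e.
  apply: (@le_trans _ _ ((x ^+ 2 * 16^-1) `^ e)); last first.
    rewrite ge0_ler_powR ?nnegrE ?(ltW e0) ?divr_ge0 ?sqr_ge0 ?(ltW V0) //.
  rewrite powRM ?sqr_ge0 ?invr_ge0 ?ler0n // xE -expRM.
  have -> : - (2 * l) * e = - 1 by rewrite /e; field; rewrite gt_eqF //; lra.
  rewrite ler_wpM2l ?expR_ge0 // -[leLHS]powRr1 ?invr_ge0 ?ler0n //.
  by apply: ger_powR => //; lra.
apply: (@le_trans _ _ (x / 16 * (expR (-1) * 16^-1))); first by lra.
apply: ler_pM => //; last by lra.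
by rewrite divr_ge0 ?ler0n // ltW.
Qed.

Lemma clipped_influence_half A i (x l : R) : increasing_set A ->
  h_influence gamma A i = x -> expR (- l) = x -> 0 <= l ->
  x / 2 <= clipped_influence l A i.
Proof.
move=> mA xE xl l0; have := clipped_influence_err l0 mA (l := [:: i]) isT.
have x0 : 0 < x by rewrite -xl expR_gt0.
rewrite big_seq1 xE; set y := clipped_influence _ _ _ => h.
have hx : expR (- (2 * (l + 5))) <= x ^+ 2 * 64^-1.
  have -> : - (2 * (l + 5)) = 2%:R * - l + - 10 by ring.
  rewrite expRD expRM_natl xl ler_wpM2l ?sqr_ge0 //.
  by rewrite expRN lef_pV2 ?posrE ?expR_gt0 ?ltr0n //; exact: expR10_ge.
have h2 : (x - y) ^+ 2 <= (x / 2) ^+ 2 by rewrite exprMn; lra.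
move: y {h} h2 => y h2; nra.
Qed.

Context (kappa : R) (kappaE : kappa = rhc_const subgauss_const).

Let kappa_gt0 : 0 < kappa. Proof. rewrite kappaE; exact: rhc_const_gt0 subgauss_const_ge1. Qed.
Let kappa_le1 : kappa <= 1. Proof. rewrite kappaE; exact: rhc_const_le1 subgauss_const_ge1. Qed.

(** * The sum over the coordinates *)

Section LogSum.
Context (A B : {set X}) (mA : increasing_set A) (mB : increasing_set B).
Let I i := h_influence gamma A i.
Let J i := h_influence gamma B i.
Let lI i := ln (1 / I i).
Let lJ i := ln (1 / J i).

Let I_ge0 i : 0 <= I i := h_influence_ge0 A i.
Let J_ge0 i : 0 <= J i := h_influence_ge0 B i.
Let lI0 i : 0 <= lI i := log1V_ge0 (I_ge0 i) (h_influence_le_half A i).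
Let lJ0 i : 0 <= lJ i := log1V_ge0 (J_ge0 i) (h_influence_le_half B i).

Let pos i := (0 < I i) && (0 < J i).
Let s i := Num.sqrt (lI i * lJ i).
Let r i := if pos i then kappa / (1408 * s i) else 0.
Let a i := clipped (lI i).
Let b i := clipped (lJ i).
Let K i := tilted gamma (r i) (a i) (b i).

Let lI_half i : pos i -> 2^-1 <= lI i.
Proof. by case/andP => I0 _; apply: log1V_ge_half I0 (h_influence_le_half A i). Qed.

Let lJ_half i : pos i -> 2^-1 <= lJ i.
Proof. by case/andP => _ J0; apply: log1V_ge_half J0 (h_influence_le_half B i). Qed.

Let s_gt0 i : pos i -> 0 < s i.
Proof.
have half (z : R) : 2^-1 <= z -> 0 < z by apply: lt_le_trans; rewrite invr_gt0.
by move=> p; rewrite sqrtr_gt0; apply: mulr_gt0; apply: half; [exact: lI_half|exact: lJ_half].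
Qed.

Let r_ge0 i : 0 <= r i.
Proof.
rewrite /r; case: ifP => [/s_gt0 s0|_]; last exact: lexx.
by apply: divr_ge0; [exact: ltW|apply: mulr_ge0; [exact: ler0n|exact: ltW]].
Qed.

Let m1 i := 2 * clip_level (lI i).
Let m2 i := 2 * clip_level (lJ i).

Let rm i : 2 * r i * (m1 i * m2 i) <= kappa.
Proof.
rewrite /r; case: ifP => [p|_]; last by rewrite mulr0 mul0r; exact: ltW.
have -> : m1 i * m2 i = 4 * (clip_level (lI i) * clip_level (lJ i)).
  rewrite /m1 /m2; move: (clip_level _) (clip_level _) => y z; ring.
apply: tilt_rate; [exact: kappa_gt0|exact: s_gt0|].
by apply: clip_level_mul; [exact: lI_half|exact: lJ_half].
Qed.

Let subA i : subgaussian (gamma := gamma) subgauss_const (m1 i) (a i).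
Proof. by apply: subgaussian_clipped => //; exact: lI0. Qed.

Let subB i : subgaussian (gamma := gamma) subgauss_const (m2 i) (b i).
Proof. by apply: subgaussian_clipped => //; exact: lJ0. Qed.

Let tilt_ge0 i u v : 0 <= 1 + r i * (a i u * b i v).
Proof.
have h : `|a i u * b i v| <= m1 i * m2 i.
  rewrite normrM; apply: ler_pM; rewrite ?normr_ge0 //.
    exact: (subgaussian_bound (subA i)).
  exact: (subgaussian_bound (subB i)).
apply: (tilt_pos (k := kappa) (z := r i * (m1 i * m2 i))); [exact: kappa_le1| |].
  by rewrite mulrA; exact: rm.
rewrite -mulrN; apply: ler_wpM2l; [exact: r_ge0|apply: le_trans h].
by rewrite -normrN; exact: ler_norm.
Qed.

Let rhc i j : pos i -> r j <= r i ->
  reverse_hypercontractive gamma (K j) (1 + (2 * lI i)^-1) (1 + (2 * lJ i)^-1).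
Proof.
move=> p rij.
apply: (tilted_reverse_hypercontractive gamma_pmf subgauss_const_ge1
  (clip_level_gt0 (lI0 j)) (clip_level_gt0 (lJ0 j)) (subA j) (subB j)
  (inv_double_itv (lI_half p)) (inv_double_itv (lJ_half p)) (r_ge0 j)).
  by rewrite -kappaE; exact: rm.
rewrite -kappaE; apply: (@le_trans _ _ ((2 * r i) ^+ 2)).
  have r2 k : 0 <= 2 * r k by apply: mulr_ge0; [exact: ler0n|exact: r_ge0].
  by apply: lerXn2r; rewrite ?nnegrE; [exact: r2|exact: r2|apply: ler_wpM2l; [exact: ler0n|]].
rewrite /r p; apply: tilt_rate_sqr; [exact: ltW|exact: lI_half|exact: lJ_half].
Qed.

(** The rate [kappa / 1408] of the correlations times the square of the constant
    of [moment_bound_ge]. *)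
Definition log_sum_const : R := kappa / 1408 * (expR (-1) / 256) ^+ 2.

Lemma covariance_ge_log_sum :
  log_sum_const * log_influence_sum gamma A B <=
  fin_measure (pmf_power gamma) (A :&: B) -
  fin_measure (pmf_power gamma) A * fin_measure (pmf_power gamma) B.
Proof.
rewrite fin_measureI_ind !fin_measure_ind.
pose ord := sort (fun i j => r j <= r i) (enum 'I_n).
have ordT i : i \in ord by rewrite mem_sort mem_enum.
apply: le_trans (covariance_ge_gains gamma_pmf (r := r) (a := a) (b := b) tilt_ge0 _ _
  (increasing_pred_mem mA) (increasing_pred_mem mB) ordT) => [|i|i]; try exact: mean_clipped.
have -> : log_sum_const * log_influence_sum gamma A B =
    \sum_(i <- ord) log_sum_const * (I i * J i / s i).
  rewrite /log_influence_sum mulr_sumr [RHS](perm_big (enum 'I_n)); last by rewrite perm_sort.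
  by rewrite big_enum.
apply: (@gains_ge_sum _ _ _ _ gamma_pmf r a b _ _ _ _ 4 _
  (fun i => clipped_influence (lI i) A i) (fun i => clipped_influence (lJ i) B i)) => //.
- by move=> i; apply: mean_clipped.
- by move=> i; apply: mean_clipped.
- by move=> i u v; apply: clipped_ndecr.
- by move=> i u v; apply: clipped_ndecr.
- by move=> i; apply: mean_clipped_sqr.
- by move=> i; apply: mean_clipped_sqr.
- move=> i l F G rl F0 G0 xF yG F4 G4.
  have [p|] := boolP (pos i); last first.
    rewrite negb_and -!leNgt => np.
    have -> : I i * J i = 0.
      apply/eqP; rewrite mulf_eq0 !eq_le I_ge0 J_ge0 !andbT; exact: np.
    rewrite mul0r mulr0 mulr_ge0 //.
    rewrite (@eq_coupled _ _ _ gamma _ l _ (fun x y => 0 * 0 + tensor F G x y)) => [|x y]; last first.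
      by rewrite mulr0 add0r.
    apply: (@le_trans _ _ (coupled gamma (fun j => tilted gamma (r j) (a j) (b j)) l (fun x y => 0 * 0))).
      by rewrite coupledZ mul0r.
    apply: (coupled_le gamma_pmf) => [j u v|x y]; last by rewrite mulr0 add0r mulr_ge0.
    by rewrite mulr_ge0 // mulr_ge0 ?gamma_pmf.1.
  have [I0 J0] := andP p; have s0 := s_gt0 p.
  have xI := clipped_influence_half mA erefl (expR_log1V I0) (lI0 i).
  have xJ := clipped_influence_half mB erefl (expR_log1V J0) (lJ0 i).
  rewrite -xF in xI; rewrite -yG in xJ.
  have bF := moment_bound_ge (expR_log1V I0) (lI_half p) F0 xI F4.
  have bG := moment_bound_ge (expR_log1V J0) (lJ_half p) G0 xJ G4.
  have main := coupled_ge_moments gamma_pmf (l := l) tilt_ge0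
    (inv_double_itv (lI_half p)) (inv_double_itv (lJ_half p))
    (fun j jl => rhc p (rl j jl)) F0 G0.
  have c0 : 0 <= expR (-1) / 256 :> R by rewrite divr_ge0 ?expR_ge0 ?ler0n.
  have := le_trans (ler_pM (mulr_ge0 (I_ge0 i) c0) (mulr_ge0 (J_ge0 i) c0) bF bG) main.
  move=> /(ler_wpM2l (r_ge0 i)); apply: le_trans.
  rewrite {1}/r p le_eqVlt; apply/orP; left; apply/eqP; rewrite /log_sum_const.
  by field; rewrite gt_eqF.
- by rewrite sort_uniq enum_uniq.
- rewrite -sorted_pairwise; last by move=> x y z /[swap]; apply: le_trans.
  by apply: sort_sorted => x y; apply: le_total.
- exact: increasing_ind.
- exact: increasing_ind.
- exact: mean_ind_sqr_le1.
- exact: mean_ind_sqr_le1.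
Qed.

End LogSum.
End Correlation.

(** * The bound with a common correlation *)

Section TalagrandRates.
Context {R : realType}.
Implicit Types l k w x : R.

Lemma expR6_ge : 27 <= expR 6 :> R.
Proof.
have h : 3 <= expR 2 :> R by have := expR_ge1Dx (2 : R); lra.
have -> : (6 : R) = 3%:R * 2 by ring.
rewrite expRM_natl exprS expr2; move: (expR _) h => y h.
have h2 : 9 <= y * y by nra.
have := ler_pM (ler0n R 3) (ler0n R 9) h h2; lra.
Qed.

Lemma clip_level_sqr l : 1 <= l -> (2 * clip_level l) * (2 * clip_level l) <= 384 * l.
Proof.
move=> l1; rewrite -expr2 /clip_level !exprMn sqr_sqrtr; lra.
Qed.

Lemma common_rate k l z : 0 < k -> 1 <= l -> z <= 384 * l -> 2 * (k / (768 * l)) * z <= k.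
Proof.
move=> k0 l1 zl; have l0 : 0 < l by lra.
have s1 : 0 < 384 * l by rewrite mulr_gt0 ?ltr0n.
have -> : 2 * (k / (768 * l)) * z = k * (z / (384 * l)) by field; rewrite gt_eqF.
by rewrite -[leRHS]mulr1; apply: ler_wpM2l; [exact: ltW|rewrite ler_pdivrMr ?mul1r].
Qed.

Lemma common_rate_sqr k l : 0 <= k -> 1 <= l ->
  (2 * (k / (768 * l))) ^+ 2 <= k ^+ 2 * (l^-1 * l^-1).
Proof.
move=> k0 l1; have l0 : 0 < l by lra.
have kl : 0 <= k / l by rewrite divr_ge0 // ltW.
apply: (@le_trans _ _ ((k / l) ^+ 2)).
  have -> : 2 * (k / (768 * l)) = k / l / 384 by field; rewrite gt_eqF.
  by move: (k / _) kl => z z0; apply: lerXn2r; rewrite ?nnegrE; lra.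
by rewrite le_eqVlt; apply/orP; left; apply/eqP; field; rewrite gt_eqF.
Qed.

(** With x = exp(1 - l), the power x^(2/l) is at least exp(- 2). *)
Lemma powR_rate_ge x l : 1 <= l -> expR (1 - l) = x ->
  expR (-2) / 16 <= ((x / 4) ^+ 2) `^ l^-1.
Proof.
move=> l1 xl; have l0 : 0 < l by lra.
have -> : (x / 4) ^+ 2 = expR (2 * (1 - l)) * 16^-1.
  by rewrite exprMn -xl -expRM_natl; congr (_ * _); field.
rewrite powRM ?expR_ge0 ?invr_ge0 ?ler0n // -expRM.
apply: ler_pM; rewrite ?expR_ge0 ?invr_ge0 ?ler0n //.
  rewrite ler_expR ler_pdivlMr //; lra.
rewrite -[leLHS]powRr1 ?invr_ge0 ?ler0n //; apply: ger_powR; first by lra.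
by rewrite invf_le1.
Qed.

(** The cross terms of I J - x y are split by the arithmetic-geometric mean
    inequality with the weights 4w and 1/(4w). *)
Lemma mul_sub_le (I J x y w : R) : 0 < w ->
  I * J <= x * y + ((I - x) ^+ 2 + (J - y) ^+ 2) * ((8 * w)^-1 + 2^-1) +
           2 * w * (I ^+ 2 + J ^+ 2).
Proof.
move=> w0; have w8 : 0 < 8 * w by rewrite mulr_gt0 ?ltr0n.
have amgm p z : p * z <= p ^+ 2 * (8 * w)^-1 + 2 * w * z ^+ 2.
  rewrite -subr_ge0.
  have -> : p ^+ 2 * (8 * w)^-1 + 2 * w * z ^+ 2 - p * z = (p - 4 * w * z) ^+ 2 / (8 * w).
    by field; rewrite gt_eqF.
  by rewrite divr_ge0 ?sqr_ge0 // ltW.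
have h1 := amgm (I - x) J; have h2 := amgm (J - y) I.
have h3 := sqr_ge0 ((I - x) + (J - y)).
move: ((8 * w)^-1) h1 h2 => v h1 h2; nra.
Qed.

End TalagrandRates.

Section Talagrand.
Context {R : realType} {q n : nat} {gamma : 'I_q -> R}.
Context (gamma_pmf : is_pmf gamma) (gamma_gt0 : forall u, 0 < gamma u).
Local Notation X := {ffun 'I_n -> 'I_q}.
Local Notation E := (mean (pmf_power gamma)).
Local Notation clipped := (clipped_score (gamma := gamma)).
Context (kappa : R) (kappaE : kappa = rhc_const subgauss_const).

Let kappa_gt0 : 0 < kappa. Proof. rewrite kappaE; exact: rhc_const_gt0 subgauss_const_ge1. Qed.
Let kappa_le1 : kappa <= 1. Proof. rewrite kappaE; exact: rhc_const_le1 subgauss_const_ge1. Qed.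

Context (A B : {set X}) (mA : increasing_set A) (mB : increasing_set B).
Let I i := h_influence gamma A i.
Let J i := h_influence gamma B i.

Lemma sum_influences_le1 : \sum_(i < n) I i * J i <= 1.
Proof.
have hA := sum_h_influence_sqr gamma_pmf gamma_gt0 mA.
have hB := sum_h_influence_sqr gamma_pmf gamma_gt0 mB.
have h : 2 * (\sum_(i < n) I i * J i) <= \sum_(i < n) I i ^+ 2 + \sum_(i < n) J i ^+ 2.
  rewrite mulr_sumr -big_split; apply: ler_sum => i _ /=.
  by move: (I i) (J i) => x y; have := sqr_ge0 (x - y); nra.
move: h hA hB; rewrite /I /J; lra.
Qed.

(** The truncation error is at most a multiple of exp(- l - 5) = x exp(- 6). *)
Lemma sum_clipped_influences_ge (l x : R) : x = \sum_(i < n) I i * J i ->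
  1 <= l -> expR (1 - l) = x ->
  x / 2 <= \sum_(i < n) clipped_influence (gamma := gamma) l A i *
                        clipped_influence (gamma := gamma) l B i.
Proof.
move=> xE l1 xl; have l0 : 0 <= l by lra.
pose w := expR (- (l + 5)); have w0 : 0 < w by exact: expR_gt0.
have wx : w * 27 <= x.
  rewrite -xl; have -> : 1 - l = - (l + 5) + 6 by ring.
  by rewrite expRD ler_wpM2l ?expR_ge0 // expR6_ge.
have w2 : expR (- (2 * (l + 5))) = w ^+ 2 by rewrite -expRM_natl mulrN.
have x1 : x <= 1 by rewrite -xl -[leRHS]expR0 ler_expR; lra.
have errA := clipped_influence_err gamma_pmf gamma_gt0 l0 mA (index_enum_uniq _).
have errB := clipped_influence_err gamma_pmf gamma_gt0 l0 mB (index_enum_uniq _).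
have sqA := sum_h_influence_sqr gamma_pmf gamma_gt0 mA.
have sqB := sum_h_influence_sqr gamma_pmf gamma_gt0 mB.
rewrite w2 in errA errB.
have := ler_sum (index_enum 'I_n) (P := xpredT) (fun i _ => mul_sub_le (I i) (J i)
   (clipped_influence (gamma := gamma) l A i) (clipped_influence (gamma := gamma) l B i) w0).
rewrite -xE !big_split /= -mulr_suml -mulr_sumr !big_split /=.
move: errA errB sqA sqB; rewrite -/I -/J.
set sA := \sum_(i <- _) _; set sB := \sum_(i <- _) _; set tA := \sum_(i < n) _; set tB := \sum_(i < n) _.
move=> errA errB sqA sqB.
have v8 : w * (8 * w)^-1 = 8^-1 by field; rewrite gt_eqF.
have v0 : 0 < (8 * w)^-1 by rewrite invr_gt0 mulr_gt0 ?ltr0n.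
set v := (8 * w)^-1 in v8 v0 *.
have h1 : (sA + sB) * (v + 2^-1) <= 32 * w ^+ 2 * (v + 2^-1).
  by apply: ler_wpM2r; [lra|lra].
have h2 : w ^+ 2 * v = w / 8 by rewrite expr2 -mulrA v8.
have h3 : 2 * w * (tA + tB) <= 4 * w by nra.
have h4 : w ^+ 2 <= w / 27 by rewrite expr2; nra.
lra.
Qed.

(** The rate [kappa / 768] of the correlations, the factor of [gains_ge_energy] with
    the bound of [powR_rate_ge], and 1/4 = 1/2 - 1/4 from the sum that remains there
    when t = x / 4. *)
Definition talagrand_const : R := kappa / 768 * (expR (-2) / 16 / 64) / 4.

Lemma covariance_ge_talagrand :
  0 < \sum_(i < n) I i * J i ->
  talagrand_const * talagrand_phi (\sum_(i < n) I i * J i) <=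
  fin_measure (pmf_power gamma) (A :&: B) -
  fin_measure (pmf_power gamma) A * fin_measure (pmf_power gamma) B.
Proof.
set x := \sum_(i < n) _ => x0.
have x1 : x <= 1 := sum_influences_le1.
have [l l1 [lE xl]] : exists2 l : R, 1 <= l & ln (expR 1 / x) = l /\ expR (1 - l) = x.
  have lnx : ln (expR 1 / x) = 1 - ln x by rewrite ln_div ?posrE ?expR_gt0 // expRK.
  exists (1 - ln x); first by rewrite lerDl oppr_ge0 ln_le0.
  by split=> //; rewrite subKr lnK.
rewrite fin_measureI_ind !fin_measure_ind /talagrand_phi lE.
have l0 : 0 <= l by lra.
have lp : 0 < l by lra.
pose r (_ : 'I_n) := kappa / (768 * l).
pose a (_ : 'I_n) := clipped l.
have r0 : 0 <= kappa / (768 * l).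
  by apply: divr_ge0; [exact: ltW|rewrite mulr_ge0 ?ler0n].
have sub : subgaussian (gamma := gamma) subgauss_const (2 * clip_level l) (clipped l).
  exact: subgaussian_clipped.
have rm := common_rate kappa_gt0 l1 (clip_level_sqr l1).
have rm2 := common_rate_sqr (ltW kappa_gt0) l1.
have e01 : 0 < l^-1 <= 1 by rewrite invr_gt0 lp invf_le1.
have rhc : reverse_hypercontractive gamma
    (tilted gamma (kappa / (768 * l)) (clipped l) (clipped l)) (1 + l^-1) (1 + l^-1).
  apply: (tilted_reverse_hypercontractive gamma_pmf subgauss_const_ge1
    (clip_level_gt0 l0) (clip_level_gt0 l0) sub sub e01 e01 r0); first by rewrite -kappaE.
  by rewrite -kappaE.
have pos i u v : 0 <= 1 + r i * (a i u * a i v).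
  have h : `|a i u * a i v| <= (2 * clip_level l) * (2 * clip_level l).
    by rewrite normrM; apply: ler_pM; rewrite ?normr_ge0 ?(subgaussian_bound sub).
  apply: (tilt_pos (k := kappa) (z := r i * ((2 * clip_level l) * (2 * clip_level l)))) => //.
    by rewrite mulrA.
  rewrite -mulrN; apply: ler_wpM2l => //; apply: le_trans h.
  by rewrite -normrN; exact: ler_norm.
apply: le_trans (covariance_ge_gains gamma_pmf (r := r) (a := a) (b := a) pos _ _
  (increasing_pred_mem mA) (increasing_pred_mem mB) (mem_enum 'I_n)) => [|i|i];
  try exact: mean_clipped.
have t0 : 0 <= x / 4 by rewrite divr_ge0 ?ler0n // ltW.
apply: le_trans (@gains_ge_energy _ _ _ _ gamma_pmf r a a _ _ _ _
  (kappa / (768 * l)) l^-1 (x / 4) _ _ _ r0 e01 t0 pos _ _ (enum_uniq _)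
  (increasing_ind mA) (increasing_ind mB)) => //; try (by move=> *; apply: mean_clipped);
  try (by move=> *; apply: clipped_ndecr).
rewrite big_enum /=.
have xy := sum_clipped_influences_ge erefl l1 xl; rewrite -/x in xy.
have en C : increasing_set C -> energy (gamma := gamma) a (enum 'I_n) (ind C) <= 1.
  move=> mC; apply: le_trans (energy_le gamma_pmf (v := 4) _ _ _ _ _) _ => // [i|i|].
  - exact: mean_clipped.
  - exact: mean_clipped_sqr.
  have := variance_ind_le (gamma := gamma) C; lra.
have hp := powR_rate_ge l1 xl.
have -> : talagrand_const * (x / l) =
    kappa / (768 * l) * (expR (-2) / 16 / 64) * (x / 4).
  by rewrite /talagrand_const; field; rewrite gt_eqF.
apply: ler_pM.
- by rewrite mulr_ge0 // !mulr_ge0 ?expR_ge0 // invr_ge0 ler0n.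
- exact: t0.
- by apply: ler_wpM2l => //; rewrite ler_wpM2r // invr_ge0 ler0n.
move: (en _ mA) (en _ mB) xy; rewrite /clipped_influence -/a.
move: (energy _ _ _) (energy _ _ _) (\sum_(i < n) _) => eA eB sxy eA1 eB1 xy.
nra.
Qed.

End Talagrand.

(** * The correlation inequality *)

Lemma log_influence_sum_ge0 (R : realType) (q n : nat) (gamma : 'I_q -> R)
  (A B : {set {ffun 'I_n -> 'I_q}}) : is_pmf gamma -> 0 <= log_influence_sum gamma A B.
Proof.
move=> pmf; apply: sumr_ge0 => i _; apply: divr_ge0; last exact: sqrtr_ge0.
by rewrite mulr_ge0 // h_influence_ge0.
Qed.

Lemma talagrand_phi_ge0 (R : realType) (x : R) : 0 <= x -> x <= 1 -> 0 <= talagrand_phi x.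
Proof.
rewrite /talagrand_phi le_eqVlt => /predU1P[<- _|x0 x1]; first by rewrite mul0r.
rewrite divr_ge0 ?(ltW x0) // ln_ge0 // ler_pdivlMr // mul1r (le_trans x1) //.
by have := expR_ge1Dx (1 : R); lra.
Qed.

Theorem theorem5p2 (R : realType) :
  exists c : R, 0 < c /\
  forall (q n : nat) (gamma : 'I_q -> R) (A B : {set {ffun 'I_n -> 'I_q}}),
    (1 < q)%N -> (1 <= n)%N ->
    is_pmf gamma -> (forall i, 0 < gamma i) ->
    increasing_set A -> increasing_set B ->
    c * Num.max (log_influence_sum gamma A B)
                (talagrand_phi
                   (\sum_(i < n) h_influence gamma A i * h_influence gamma B i))
    <= fin_measure (pmf_power gamma) (A :&: B)
       - fin_measure (pmf_power gamma) A * fin_measure (pmf_power gamma) B.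
Proof.
(* a variable in place of the explicit constant, shared by both bounds *)
have [kappa kappaE] : exists k : R, k = rhc_const subgauss_const by eexists.
have k0 : 0 < kappa by rewrite kappaE; exact: rhc_const_gt0 subgauss_const_ge1.
pose c1 : R := log_sum_const kappa; pose c2 : R := talagrand_const kappa.
have c10 : 0 < c1.
  apply: mulr_gt0; first by rewrite divr_gt0 ?ltr0n.
  by rewrite exprn_gt0 // divr_gt0 ?expR_gt0 ?ltr0n.
have c20 : 0 < c2.
  by rewrite /c2 /talagrand_const !mulr_gt0 ?invr_gt0 ?expR_gt0 ?ltr0n.
exists (Num.min c1 c2); split; first by rewrite lt_min c10 c20.
move=> q n gamma A B _ _ pmf gpos mA mB.
have h1 := covariance_ge_log_sum pmf gpos kappaE mA mB.
have S0 := log_influence_sum_ge0 A B pmf.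
set S := log_influence_sum gamma A B in h1 S0 *.
set x := \sum_(i < n) _; set cov := _ - _ in h1 *.
have cov0 : 0 <= cov by apply: le_trans h1; rewrite mulr_ge0 // ltW.
have x1 : x <= 1 := sum_influences_le1 pmf gpos mA mB.
have x0 : 0 <= x by apply: sumr_ge0 => i _; rewrite mulr_ge0 // h_influence_ge0.
have h2 : c2 * talagrand_phi x <= cov.
  move: x0; rewrite le_eqVlt => /predU1P[<-|xp].
    by rewrite /talagrand_phi mul0r mulr0.
  exact: (covariance_ge_talagrand pmf gpos kappaE mA mB).
have p0 := talagrand_phi_ge0 x0 x1.
have [_|_] := leP S (talagrand_phi x).
  by apply: le_trans h2; apply: ler_wpM2r => //; rewrite ge_min lexx orbT.
by apply: le_trans h1; apply: ler_wpM2r => //; rewrite ge_min lexx.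
Qed.
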